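(* For each $s=1,\dots,15$ and $t=s$, let $r$ be as listed below. Then an SBP operator with parameters $(s,t,r)$ and diagonal $P$ exists, and $r$ is the smallest positive integer with this property (for the given $s$ and $t=s$). Moreover, for this $(s,t,r)$, the number $\mathrm{dof}\,P$ of degrees of freedom in $P$ (with $0$ meaning that $P$ is unique), the number $\mathrm{dof}\,D$ of degrees of freedom in $D$ for the optimal $P$ (reported only for $s\le 8$), and the optimal value $\mu=\max\min_i x_i$ (to the digits shown) are as follows: $$\begin{array}{cccccl} s & t & r & \mathrm{dof}\,P & \mathrm{dof}\,D & \mu\\ \hline 1&1&1&0&0&5.000\times10^{-1}\\ 2&2&4&0&0&3.541\times10^{-1}\\ 3&3&6&0&1&3.159\times10^{-1}\\ 4&4&8&0&3&2.575\times10^{-1}\\ 5&5&11&1&10&2.077\times10^{-1}\\ 6&6&14&2&21&9.683\times10^{-3}\\ 7&7&19&5&55&1.907\times10^{-1}\\ 8&8&23&7&91&4.652\times10^{-2}\\ 9&9&28&10&\text{---}&4.622\times10^{-2}\\ 10&10&34&14&\text{---}&8.357\times10^{-2}\\ 11&11&40&18&\text{---}&3.907\times10^{-2}\\ 12&12&47&23&\text{---}&5.286\times10^{-2}\\ 13&13&54&28&\text{---}&1.933\times10^{-2}\\ 14&14&62&34&\text{---}&1.863\times10^{-2}\\ 15&15&71&41&\text{---}&4.559\times10^{-2} \end{array}$$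
   Context: All vectors and matrices are indexed starting from $0$. Conventions: $0^0=1$, and any term of the form $j\,x^{j-1}$ with $j=0$ equals $0$ (also when $x=0$). $\delta$ is the Kronecker delta. Centered stencil: $\alpha_1,\dots,\alpha_s$ are the coefficients of the standard centered finite difference approximation of the first derivative of order $2s$ with unit step, $f'(x)\approx\sum_{j=1}^s\alpha_j\,(f(x+j)-f(x-j))$; explicitly $\alpha_j=\dfrac{(-1)^{j+1}(s!)^2}{j\,(s-j)!\,(s+j)!}$. Let $s,t,r$ be positive integers. Since the interior rows carry the full centered stencil, an SBP operator can exist only if $r\ge s$; for $r<s$ it is understood not to exist. For $r\ge s$, let $C\in\mathbb{R}^{r\times s}$ be given by $C_{k\ell}=\alpha_{r+\ell-k}$ if $1\le r+\ell-k\le s$ and $C_{k\ell}=0$ otherwise ($0\le k\le r-1$, $0\le\ell\le s-1$). SBP operator with parameters $(s,t,r)$ and diagonal $P$ (unit step size) on $n\ge 2r+s$ grid points $0,1,\dots,n-1$: a pair of matrices $P,D\in\mathbb{R}^{n\times n}$ such that (1) $P=\mathrm{diag}(\tilde P,I_{n-2r},\hat P)$ with $\tilde P,\hat P\in\mathbb{R}^{r\times r}$ diagonal and positive definite. (2) For each interior row $i=r,\dots,n-r-1$: $D_{i,i+j}=\alpha_j$ and $D_{i,i-j}=-\alpha_j$ for $1\le j\le s$, and all other entries of row $i$ are $0$. (3) The first $r$ and last $r$ rows of $D$ are finite difference approximations of the first derivative of order $t$: for each such row $i$ and each $m=0,1,\dots,t$, $\sum_{j=0}^{n-1}D_{ij}\,j^m=m\,i^{m-1}$.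 (4) The energy condition $PD+D^TP=e_{n-1}e_{n-1}^T-e_0e_0^T$ holds, where $e_0,\dots,e_{n-1}$ is the canonical basis of $\mathbb{R}^n$. (5) $D$ has the form $$D=\begin{bmatrix}\tilde P^{-1}&0&0\\0&I&0\\0&0&\hat P^{-1}\end{bmatrix}\begin{bmatrix}B&C_0&0\\-C_0^T&\tilde D&-\hat C_0^T\\0&\hat C_0&\hat B\end{bmatrix}$$ with $B,\hat B\in\mathbb{R}^{r\times r}$, $C_0=[\,C\;\;0\,]$ and $\hat C_0=[\,0\;\;\hat C\,]$ in $\mathbb{R}^{r\times(n-2r)}$, where $\hat C\in\mathbb{R}^{r\times s}$ (the blocks $C_0,\tilde D,\hat C_0$ are determined by the interior rows in (2)). We say an SBP operator with parameters $(s,t,r)$ and diagonal $P$ exists if such a pair exists for every $n\ge 2r+s$. Quantities in the table. The top-left boundary block is considered; the bottom-right block is treated analogously (by symmetry) and is not counted separately. Let $S\subset\mathbb{R}^r$ be the affine set of all $x=(x_0,\dots,x_{r-1})$ (with $x_k$ playing the role of $\tilde P_{kk}$, no sign restriction) such that $$\sum_{k=0}^{r-1}(p+q)\,k^{p+q-1}x_k=\sum_{k=0}^{r-1}\sum_{\ell=0}^{s-1}\bigl(k^p(r+\ell)^q+k^q(r+\ell)^p\bigr)C_{k\ell}-\delta_{p0}\delta_{q0}$$ for all $p=0,1,\dots,t$ and $q=p,p+1,\dots,t$. Then: $\mathrm{dof}\,P$ is the dimension of $S$. $\mu$ is the maximum of $\min_{0\le i\le r-1}x_i$ over $x\in S$.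 The optimal $P$ is the one with $\tilde P=\mathrm{diag}(x)$, where $x\in S$ attains this maximum. $\mathrm{dof}\,D$ is, for the optimal $P$, the dimension of the affine set of $B\in\mathbb{R}^{r\times r}$ satisfying $B+B^T=-e_0e_0^T$ (here $e_0\in\mathbb{R}^r$) and $BX+C\tilde X=\tilde PY$, where $X,Y\in\mathbb{R}^{r\times(t+1)}$ and $\tilde X\in\mathbb{R}^{s\times(t+1)}$ are given by $X_{ij}=i^j$, $\tilde X_{ij}=(r+i)^j$, $Y_{ij}=j\,i^{j-1}$; these two equations are conditions (4) and (3) for the top $r$ rows. *)

(* Defs.v *)
From HB Require Import structures.
From mathcomp Require Import all_boot all_order all_algebra.
From mathcomp Require Import boolp classical_sets reals.

Unset Printing Implicit Defensive.

Import Order.TTheory GRing.Theory Num.Theory.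
Local Open Scope classical_set_scope.
Local Open Scope ring_scope.

Section SBP.
Context {R : realType}.

Definition posdefmx {n : nat} (A : 'M[R]_n) : Prop :=
  A^T = A /\ forall x : 'rV[R]_n, x != 0 -> 0 < (x *m A *m x^T) 0 0.

(* The vector e_k of R^n. *)
Definition canvec (n k : nat) : 'cV[R]_n := \col_i (i == k :> nat)%:R.

(* The derivative of x^m at the point i; the truncated exponent m.-1 makes
   it 0 for m = 0, and 0^0 = 1 gives 1 for i = 0 and m = 1. *)
Definition dmon (m i : nat) : R := m%:R * i%:R ^+ m.-1.

(* Centered stencil of order 2s; meaningful for 1 <= j <= s only, since the
   natural subtraction s - j is truncated. *)
Definition alpha (s j : nat) : R :=
  (-1) ^+ j.+1 * s`!%:R ^+ 2 / (j%:R * (s - j)`!%:R * (s + j)`!%:R).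

(* Here k < r, so that r + l - k is a genuine subtraction. *)
Definition stencilC (s r : nat) : 'M[R]_(r, s) :=
  \matrix_(k, l) if (1 <= r + l - k <= s)%N then alpha s (r + l - k) else 0.

Lemma sbp_size (s r n : nat) :
  (2 * r + s <= n -> r + ((n - 2 * r) + r) = n)%N.
Proof.
by move=> h; rewrite [RHS](_ : _ = 2 * r + (n - 2 * r))%N;
   [rewrite mulSn mul1n addnCA addnC | rewrite subnKC ?(leq_trans (leq_addr _ _) h)].
Qed.

Lemma sbp_interior (s r n : nat) : (2 * r + s <= n -> s <= n - 2 * r)%N.
Proof. by move=> h; rewrite leq_subRL // (leq_trans (leq_addr _ _) h). Qed.

(* The casts [castmx] only transport along r + ((n - 2r) + r) = n and along
   the splittings of n - 2r used for [ C 0 ] and [ 0 Chat ]. *)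
Definition is_sbp (s t r : nat) {n : nat} (hn : (2 * r + s <= n)%N)
    (P D : 'M[R]_n) : Prop :=
  let m := (n - 2 * r)%N in
  let e := sbp_size s r n hn in
  let hs := sbp_interior s r n hn in
  exists Pt Ph : 'M[R]_r,
  [/\ [/\ is_diag_mx Pt, posdefmx Pt, is_diag_mx Ph, posdefmx Ph
        & P = castmx (e, e)
                (block_mx Pt 0 0 (block_mx (1%:M : 'M_m) 0 0 Ph))],
      (forall i j : 'I_n, (r <= i < n - r)%N ->
         D i j = if (i < j <= i + s)%N then alpha s (j - i)
                 else if (j < i <= j + s)%N then - alpha s (i - j)
                 else 0),
      (forall (i : 'I_n) (k : nat), (i < r)%N || (n - r <= i)%N -> (k <= t)%N ->
         \sum_(j < n) D i j * j%:R ^+ k = dmon k i),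
      P *m D + D^T *m P = canvec n n.-1 *m (canvec n n.-1)^T
                          - canvec n 0 *m (canvec n 0)^T
    & exists (B Bh : 'M[R]_r) (Ch : 'M[R]_(r, s)) (Dt : 'M[R]_m),
      let C0 : 'M[R]_(r, m) :=
        castmx (erefl r, subnKC hs) (row_mx (stencilC s r) 0) in
      let Ch0 : 'M[R]_(r, m) :=
        castmx (erefl r, subnK hs) (row_mx 0 Ch) in
      D = castmx (e, e)
            (block_mx (invmx Pt) 0 0 (block_mx (1%:M : 'M_m) 0 0 (invmx Ph))
             *m block_mx B             (row_mx C0 0)
                         (col_mx (- C0^T) 0) (block_mx Dt (- Ch0^T) Ch0 Bh))].

(* Affine sets: A = x0 + U with U a linear subspace of dimension d. *)
Definition affine_dim {V : vectType R} (A : set V) (d : nat) : Prop :=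
  exists (x0 : V) (U : {vspace V}),
    \dim U = d /\ forall x : V, A x <-> x - x0 \in U.

Definition is_min (A : set R) (m : R) : Prop := A m /\ lbound A m.
Definition is_max (A : set R) (m : R) : Prop := A m /\ ubound A m.

Definition normset (s t r : nat) : set 'rV[R]_r :=
  [set x | forall p q : nat, (p <= q)%N -> (q <= t)%N ->
     \sum_(k < r) dmon (p + q) k * x 0 k
     = \sum_(k < r) \sum_(l < s)
         (k%:R ^+ p * (r + l)%:R ^+ q + k%:R ^+ q * (r + l)%:R ^+ p)
         * stencilC s r k l
       - (p == 0%N)%:R * (q == 0%N)%:R].

Definition is_mu (s t r : nat) (mu : R) : Prop :=
  is_max [set m | exists2 x, normset s t r x & is_min (range (x 0)) m] mu.

Definition is_optimal (s t : nat) {r : nat} (x : 'rV[R]_r) : Prop :=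
  normset s t r x /\ exists2 mu, is_mu s t r mu & is_min (range (x 0)) mu.

(* The possible blocks B for the top-left part diag(x) of P. *)
Definition boundaryset (s t : nat) {r : nat} (x : 'rV[R]_r) : set 'M[R]_r :=
  [set B | B + B^T = - (canvec r 0 *m (canvec r 0)^T) /\
     let X : 'M[R]_(r, t.+1) := \matrix_(i, j) i%:R ^+ j in
     let Xt : 'M[R]_(s, t.+1) := \matrix_(i, j) (r + i)%:R ^+ j in
     let Y : 'M[R]_(r, t.+1) := \matrix_(i, j) dmon j i in
     B *m X + stencilC s r *m Xt = diag_mx x *m Y].

(* The printed decimal a.bcd * 10^-e, encoded as (a, bcd, e), and one unit of
   its last digit. *)
Definition dec_value (c : nat * nat * nat) : R :=
  let: (a, f, e) := c in (a%:R + f%:R / 10%:R ^+ 3) / 10%:R ^+ e.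
Definition dec_unit (c : nat * nat * nat) : R :=
  let: (_, _, e) := c in 1 / 10%:R ^+ (e + 3).

(* The printed decimal is obtained from x by rounding to nearest or by
   truncation.  Both occur in the table: 17/48 = 0.35416... is printed as
   3.541e-1, and 0.25745... as 2.575e-1. *)
Definition shown_as (x : R) (c : nat * nat * nat) : Prop :=
  `|x - dec_value c| <= dec_unit c / 2%:R
  \/ dec_value c <= x < dec_value c + dec_unit c.

End SBP.

Definition sbp_exists (R : realType) (s t r : nat) : Prop :=
  (s <= r)%N /\
  forall (n : nat) (hn : (2 * r + s <= n)%N),
    exists P D : 'M[R]_n, is_sbp s t r hn P D.

(* Columns: s, t, r, dof P, dof D (None where not reported), mu. *)
Definition sbp_table :
    seq (nat * nat * nat * nat * option nat * (nat * nat * nat)) :=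
  [:: ( 1,  1,  1,  0, Some  0, (5, 000, 1));
      ( 2,  2,  4,  0, Some  0, (3, 541, 1));
      ( 3,  3,  6,  0, Some  1, (3, 159, 1));
      ( 4,  4,  8,  0, Some  3, (2, 575, 1));
      ( 5,  5, 11,  1, Some 10, (2, 077, 1));
      ( 6,  6, 14,  2, Some 21, (9, 683, 3));
      ( 7,  7, 19,  5, Some 55, (1, 907, 1));
      ( 8,  8, 23,  7, Some 91, (4, 652, 2));
      ( 9,  9, 28, 10, None,    (4, 622, 2));
      (10, 10, 34, 14, None,    (8, 357, 2));
      (11, 11, 40, 18, None,    (3, 907, 2));
      (12, 12, 47, 23, None,    (5, 286, 2));
      (13, 13, 54, 28, None,    (1, 933, 2));
      (14, 14, 62, 34, None,    (1, 863, 2));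
      (15, 15, 71, 41, None,    (4, 559, 2))]%N.

(* Main.v *)
Require Import Defs.
From Stdlib Require Import ZArith.
From HB Require Import structures.
From mathcomp Require Import all_boot all_order all_algebra.
From mathcomp Require Import boolp classical_sets reals.
From mathcomp Require Import ring lra zify ssrZ.

Import Order.TTheory GRing.Theory Num.Theory.
Local Open Scope ring_scope.
Delimit Scope Z_scope with bZ.
Set Implicit Arguments.
Unset Strict Implicit.

(** Everything rests on the affine set S of admissible boundary weights x.

    The right-hand sides of its equations are sums of
    alpha_(b - a) (a^p b^q + a^q b^p) over the pairs a < r <= b of grid points
    that the stencil couples across a cut placed at r.  Moving the cut one step
    to the right changes such a sum by (p + q) r^(p + q - 1), because the
    stencil differentiates polynomials of degree at most s exactly
    ([crossing_succ]).  Hence, as soon as the sums at the cut 0 depend on p + q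
    only (a finite identity, checked for each s), S is given by the 2s equations
      sum_k k^m x_k = sum_(k < r) k^m + c_(m+1) / (m + 1)     (m < 2s)
    with constants c independent of r ([normset_moments]).  This is a
    Vandermonde system, so S has dimension r - 2s ([affine_dim_moments]).

    For x in S, conditions (3) and (4) on the top rows ask for a matrix B whose
    symmetric part and whose product with X are prescribed; the equations of S
    say exactly that these two demands are compatible
    ([symmetric_part_solvable]), and two solutions differ by a skew matrix
    killing X, which leaves C(r - t - 1, 2) parameters ([boundaryset_dim]).  If
    x is moreover positive, then B, the interior stencil and the reflection of B
    through the midpoint of the grid form an SBP operator on every admissible
    grid ([sbp_of_boundary]); conversely every SBP operator yields such an x
    ([sbp_boundary]).  So existence means that S has a positive point.

    The rest is linear programming.  Let L_r be the linear form on polynomials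
    of degree < 2s such that sum_k w(k) x_k = L_r(w) for all x in S.  If w >= 0
    on 0, ..., r - 1 and w is not zero at all of these points, then
    min_k x_k <= L_r(w) / sum_(k < r) w(k).  In every row with s > 1 the best
    bound mu comes from a polynomial w = - prod_i (X - i) over 2s - 1 integer
    nodes, and the weights attaining it equal mu off the nodes and are determined
    on the nodes by Lagrange interpolation ([moment_lp]).  A list of nodes thus
    certifies mu.  A second list, with w >= 0 on 0, ..., r - 2 and
    L_(r-1)(w) < 0, excludes positive points of S for every size r' < r at once,
    because L_(r')(w) <= L_(r-1)(w) ([no_positive_norm]).

    After clearing denominators all hypotheses on the node lists are
    inequalities between integers, which are evaluated ([table_checked]).  The
    row s = 1, where r < 2s, is computed by hand. *)

(** * Moment form of the norm conditions *)

Section Moments.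
Context {R : realType}.
Implicit Types (s t r p q m k : nat) (o : R).

Definition odd_moment s m : R :=
  \sum_(j < s) alpha s j.+1 * (j.+1%:R ^+ m - (- j.+1%:R) ^+ m).

(** Only the moments up to s are demanded, since the powers p and q in the norm
    conditions do not exceed t = s. *)
Definition exact_stencil s := forall m, (m <= s)%N -> odd_moment s m = (m == 1%N)%:R.

Definition sym_mon p q (a b : R) := a ^+ p * b ^+ q + a ^+ q * b ^+ p.

(** The sum over the pairs a = o + i - j < o <= b = o + i at distance j <= s,
    that is, over the stencil couplings across a cut at o. *)
Definition crossing s p q o : R :=
  \sum_(j < s) alpha s j.+1 *
    \sum_(i < j.+1) sym_mon p q (o + i%:R - j.+1%:R) (o + i%:R).

Lemma exact_stencil_pow s q o : exact_stencil s -> (q <= s)%N ->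
  \sum_(j < s) alpha s j.+1 * ((o + j.+1%:R) ^+ q - (o - j.+1%:R) ^+ q)
  = q%:R * o ^+ q.-1.
Proof.
move=> hs hq.
have -> : \sum_(j < s) alpha s j.+1 * ((o + j.+1%:R) ^+ q - (o - j.+1%:R) ^+ q)
   = \sum_(i < q.+1) (o ^+ (q - i) *+ 'C(q, i)) * odd_moment s i.
  under eq_bigr => j _ do rewrite !exprDn -sumrB mulr_sumr.
  rewrite exchange_big /=; apply: eq_bigr => i _.
  rewrite /odd_moment mulr_sumr; apply: eq_bigr => j _.
  by rewrite -[in X in _ = X]mulr_natr -[X in _ - X]mulr_natr -[X in X - _]mulr_natr; ring.
under eq_bigr => i _ do rewrite hs ?(leq_trans _ hq) -1?ltnS //.
case: q hq => [|q] hq; first by rewrite big_ord1 /= mulr0 mul0r.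
rewrite (bigD1 (inord 1)) //= big1 ?addr0.
  by rewrite inordK // eqxx mulr1 bin1 subn1 mulr_natl.
move=> i hi; case: eqP => [h|_]; last by rewrite mulr0.
by case/eqP: hi; apply: val_inj; rewrite /= inordK.
Qed.

(** Along each diagonal b - a = j the sum telescopes, and the two boundary terms
    left over are central differences of x^p and x^q at o. *)
Lemma crossing_succ s p q o : exact_stencil s -> (p <= s)%N -> (q <= s)%N ->
  crossing s p q (o + 1) = crossing s p q o + (p + q)%:R * o ^+ (p + q).-1.
Proof.
move=> hs hp hq; apply/eqP; rewrite [X in _ == X]addrC -subr_eq; apply/eqP.
rewrite /crossing -sumrB.
transitivity (\sum_(j < s) alpha s j.+1 *
   (sym_mon p q o (o + j.+1%:R) - sym_mon p q (o - j.+1%:R) o)).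
  apply: eq_bigr => j _; rewrite -mulrBr -sumrB; congr (_ * _).
  pose f (i : nat) := sym_mon p q (o + i%:R - j.+1%:R) (o + i%:R).
  rewrite -(big_mkord predT (fun i => sym_mon p q (o + 1 + i%:R - j.+1%:R) (o + 1 + i%:R) - f i)).
  rewrite (eq_bigr (fun i => f i.+1 - f i)); last first.
    by move=> i _; rewrite /f -(addrA o) (addrC 1) natr1.
  by rewrite telescope_sumr // /f addrK addr0.
transitivity (o ^+ p * (q%:R * o ^+ q.-1) + o ^+ q * (p%:R * o ^+ p.-1)).
  rewrite -(exact_stencil_pow o hs hq) -(exact_stencil_pow o hs hp) !mulr_sumr -big_split /=.
  by apply: eq_bigr => j _; rewrite /sym_mon; ring.
case: p hp => [|p] hp; case: q hq => [|q] hq;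
  rewrite ?add0n ?addn0 ?expr0 ?mul1r ?mul0r ?mulr0 ?addr0 ?add0r //=.
by rewrite natrD addnS !exprS !exprD; ring.
Qed.

Lemma crossing_nat s p q r : exact_stencil s -> (p <= s)%N -> (q <= s)%N ->
  crossing s p q r%:R = crossing s p q 0 + \sum_(k < r) dmon (p + q) k.
Proof.
move=> hs hp hq; elim: r => [|r IH]; first by rewrite big_ord0 addr0.
by rewrite -natr1 crossing_succ // IH big_ord_recr /= addrA.
Qed.

(** The entries of C are the couplings across the cut at r; for s <= r none of
    them involves a point below 0. *)
Lemma crossing_stencilC s p q r : (s <= r)%N ->
  \sum_(k < r) \sum_(l < s) (k%:R ^+ p * (r + l)%:R ^+ q + k%:R ^+ q * (r + l)%:R ^+ p)
      * stencilC s r k l = crossing s p q r%:R.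
Proof.
move=> hr.
rewrite exchange_big /= /crossing.
transitivity (\sum_(l < s) \sum_(j < s | (l <= j)%N)
   alpha s j.+1 * sym_mon p q (r%:R + l%:R - j.+1%:R) (r%:R + l%:R)); last first.
  rewrite (exchange_big_dep predT) //=; apply: eq_bigr => j _.
  rewrite mulr_sumr.
  rewrite (big_ord_widen_cond s predT (fun l => alpha s j.+1 *
     sym_mon p q (r%:R + l%:R - j.+1%:R) (r%:R + l%:R))) //.
apply: eq_bigr => l _.
have hl := ltn_ord l.
case: r hr => [|r] hr; first by exfalso; lia.
under eq_bigr => k _ do rewrite mxE.
rewrite (bigID (fun k : 'I_r.+1 => (1 <= r.+1 + l - k <= s)%N)) /=.
rewrite [X in _ + X]big1 ?addr0; last first.
  by move=> k /negbTE ->; rewrite mulr0.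
have s0 : (0 < s)%N by lia.
have hd n : nat_of_ord (insubd (Ordinal s0) n) = if (n < s)%N then n else 0%N.
  by rewrite -[LHS]/(val _) val_insubd.
(* For fixed l, the nonzero entries of the column are indexed by the distance
   between the two coupled points. *)
rewrite (reindex_onto (fun j : 'I_s => inord (r.+1 + l - j.+1) : 'I_r.+1)
   (fun k : 'I_r.+1 => insubd (Ordinal s0) (r + l - k)%N)) /=; last first.
  move=> k hk; have hk' := ltn_ord k.
  apply: ord_inj; rewrite hd (_ : (r + l - k < s)%N = true); last by lia.
  by rewrite inordK; lia.
apply: eq_big => [j|j].
  have hj := ltn_ord j; rewrite -val_eqE /= hd.
  case: (leqP l j) => hlj; first by rewrite inordK; [case: ifP; lia | lia].
  have := ltn_ord (inord (r.+1 + l - j.+1) : 'I_r.+1).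
  by case: ifP; lia.
have hj := ltn_ord j; rewrite -val_eqE /= hd => hP.
have hlj : (l <= j)%N.
  have := ltn_ord (inord (r.+1 + l - j.+1) : 'I_r.+1).
  by move: hP; case: ifP; lia.
move: hP; rewrite inordK; last by lia.
move=> /andP[-> _].
have -> : (r.+1 + l - (r.+1 + l - j.+1))%N = j.+1 by lia.
rewrite mulrC natrB; last by lia.
by rewrite natrD.
Qed.

(** The common value of the crossing sums at the cut 0 for p + q = m, read off at
    the largest q <= s. *)
Definition boundary_const s m : R := crossing s (m - minn m s) (minn m s) 0.

Definition consistent_stencil s := forall p q, (p <= q)%N -> (q <= s)%N ->
  crossing s p q 0 - (p == 0%N)%:R * (q == 0%N)%:R
  = if (p + q == 0)%N then 0 else boundary_const s (p + q).

Definition norm_moment s r m : R :=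
  \sum_(k < r) k%:R ^+ m + boundary_const s m.+1 / m.+1%:R.

(** The equation for (p, q) becomes (p + q) times the moment equation for
    m = p + q - 1, so it is the same for all pairs with equal p + q, and every
    m < 2s occurs. *)
Lemma normset_moments s r (x : 'rV[R]_r) :
  exact_stencil s -> consistent_stencil s -> (s <= r)%N ->
  normset s s r x <->
  forall m, (m < 2 * s)%N -> \sum_(k < r) k%:R ^+ m * x 0 k = norm_moment s r m.
Proof.
move=> hs hc hr.
have key p q : (p <= q)%N -> (q <= s)%N -> (0 < p + q)%N ->
  (\sum_(k < r) dmon (p + q) k * x 0 k
     = \sum_(k < r) \sum_(l < s)
         (k%:R ^+ p * (r + l)%:R ^+ q + k%:R ^+ q * (r + l)%:R ^+ p)
         * stencilC s r k l
       - (p == 0%N)%:R * (q == 0%N)%:R)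
  <-> \sum_(k < r) k%:R ^+ (p + q).-1 * x 0 k = norm_moment s r (p + q).-1.
  move=> hpq hq h0.
  rewrite crossing_stencilC // crossing_nat ?(leq_trans hpq) // addrAC hc //.
  rewrite /norm_moment prednK // -[(p + q == 0)%N]negbK -lt0n h0 /=.
  set c := boundary_const _ _; set n := (p + q)%N in h0 *.
  have n0 : n%:R != 0 :> R by rewrite pnatr_eq0 -lt0n.
  have e1 : \sum_(k < r) dmon n k * x 0 k = n%:R * \sum_(k < r) k%:R ^+ n.-1 * x 0 k.
    by rewrite mulr_sumr; apply: eq_bigr => k _; rewrite /dmon mulrA.
  have e2 : c + \sum_(k < r) dmon n k = n%:R * (\sum_(k < r) k%:R ^+ n.-1 + c / n%:R).
    by rewrite /dmon -mulr_sumr mulrDr mulrCA divff // mulr1 addrC.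
  by rewrite e1 e2; split => [/(mulfI n0)|->].
split=> h.
  move=> m hm.
  have e : (m.+1 - minn m.+1 s + minn m.+1 s)%N = m.+1 by lia.
  have := key (m.+1 - minn m.+1 s)%N (minn m.+1 s).
  rewrite e /= => -[|||+ _]; [lia | lia | by [] |].
  by rewrite -[X in dmon X]e; apply; apply: h; lia.
move=> p q hpq hq.
case: (posnP (p + q)) => h0; last first.
  by apply/key => //; apply: h; lia.
have [-> ->] : p = 0%N /\ q = 0%N by lia.
rewrite crossing_stencilC // crossing_nat //.
rewrite addrAC hc // eqxx add0r.
by rewrite [RHS]big1 ?[LHS]big1 // => k _; rewrite /dmon !mul0r.
Qed.

End Moments.

(** * A linear program for quadrature weights *)

Section MomentLP.
Context {R : realFieldType}.
Implicit Types (lam : nat -> R) (d r m k : nat) (p w : {poly R}) (I : seq nat).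

(** The linear form on polynomials with moments [lam]; coefficients of degree d
    and more are ignored. *)
Definition momfun lam d p : R := \sum_(m < d) p`_m * lam m.

Fact momfun_is_linear lam d : linear_for *%R (momfun lam d).
Proof.
move=> a p q; rewrite /momfun mulr_sumr -big_split /=; apply: eq_bigr => m _.
by rewrite coefD coefZ mulrDl mulrA.
Qed.
HB.instance Definition _ lam d :=
  GRing.isLinear.Build R {poly R} R *%R (momfun lam d) (momfun_is_linear lam d).

Lemma momfunXn lam d m : (m < d)%N -> momfun lam d 'X^m = lam m.
Proof.
move=> hm; rewrite /momfun (bigD1 (Ordinal hm)) //= coefXn eqxx mul1r big1 ?addr0 // => i hi.
rewrite coefXn; case: eqP => [e|_]; last by rewrite mul0r.
by case/eqP: hi; apply: ord_inj.
Qed.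

Definition has_moments r d lam (x : 'rV[R]_r) :=
  forall m, (m < d)%N -> \sum_(k < r) k%:R ^+ m * x 0 k = lam m.

Lemma has_moments_poly r d lam (x : 'rV[R]_r) p : has_moments d lam x -> (size p <= d)%N ->
  \sum_(k < r) p.[k%:R] * x 0 k = momfun lam d p.
Proof.
move=> hx hp; under eq_bigr => k _ do rewrite (horner_coef_wide _ hp) mulr_suml.
rewrite exchange_big; apply: eq_bigr => m _ /=.
by rewrite -hx // mulr_sumr; apply: eq_bigr => k _; rewrite mulrA.
Qed.

Definition nodepoly I : {poly R} := \prod_(i <- I) ('X - i%:R%:P).

Lemma size_nodepoly I : size (nodepoly I) = (size I).+1.
Proof.
by rewrite /nodepoly -(big_map (fun i : nat => i%:R : R) predT (fun z => 'X - z%:P)) size_prod_XsubC size_map.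
Qed.

Lemma nodepoly_neq0 I : nodepoly I != 0.
Proof. by rewrite -size_poly_eq0 size_nodepoly. Qed.

Lemma horner_nodepoly I (a : R) : (nodepoly I).[a] = \prod_(i <- I) (a - i%:R).
Proof. by rewrite horner_prod; apply: eq_bigr => i _; rewrite !hornerE. Qed.

Lemma nodepoly_rem I i : uniq I -> i \in I -> (nodepoly (rem i I)).[i%:R] != 0.
Proof.
move=> uI iI; rewrite horner_nodepoly prodf_seq_neq0; apply/allP => j /=.
by rewrite rem_filter // mem_filter subr_eq0 eqr_nat eq_sym => /andP[].
Qed.

Lemma nodepoly_rem0 I i j : j \in rem i I -> (nodepoly (rem i I)).[j%:R] = 0.
Proof.
by move=> h; rewrite horner_nodepoly; rewrite (big_rem j) //= subrr mul0r.
Qed.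

(** The difference between p and its Lagrange interpolant vanishes at the nodes,
    so by its degree it is a multiple of the node polynomial. *)
Lemma interpolation I p : uniq I -> (size p <= (size I).+1)%N ->
  exists c, p = \sum_(i <- I) (p.[i%:R] / (nodepoly (rem i I)).[i%:R]) *: nodepoly (rem i I)
            + c *: nodepoly I.
Proof.
move=> uI hp.
set S := \sum_(i <- I) _.
have hS j : j \in I -> S.[j%:R] = p.[j%:R].
  move=> jI; rewrite /S horner_sum (bigD1_seq j) //= hornerZ divfK ?nodepoly_rem //.
  rewrite big_seq_cond big1 ?addr0 // => i /andP[iI ij].
  have ji : j \in rem i I by rewrite rem_filter // mem_filter jI /= eq_sym ij.
  by rewrite hornerZ (nodepoly_rem0 ji) mulr0.
have sS : (size S <= (size I).+1)%N.
  rewrite /S; apply: (leq_trans (size_sum _ _ _)); apply/bigmax_leqP_seq => i iI _.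
  apply: (leq_trans (size_scale_leq _ _)); rewrite size_nodepoly size_rem //.
  by case: (I) iI.
have dv : nodepoly I %| (p - S).
  rewrite /nodepoly -(big_map (fun i : nat => i%:R : R) predT (fun z => 'X - z%:P)).
  apply: uniq_roots_dvdp.
    by apply/allP => _ /mapP[j jI ->]; rewrite rootE hornerD hornerN hS // subrr.
  by rewrite uniq_rootsE map_inj_uniq // => a b /eqP; rewrite eqr_nat => /eqP.
have hq : (size ((p - S)%R %/ nodepoly I)%R <= 1)%N.
  rewrite size_divp ?nodepoly_neq0 // size_nodepoly leq_subLR addn1.
  by rewrite (leq_trans (size_polyD _ _)) // geq_max hp size_polyN.
exists ((p - S) %/ nodepoly I)`_0.
by rewrite -mul_polyC -size1_polyC // divpK // addrC subrK.
Qed.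

Lemma sum_mem_nodes I r (F : nat -> R) : uniq I -> all (fun i => i < r)%N I ->
  \sum_(k < r | val k \in I) F k = \sum_(i <- I) F i.
Proof.
move=> uI /allP hI; rewrite -(big_mkord (fun k => k \in I)) -big_filter; apply: perm_big.
apply: uniq_perm => //; first by rewrite filter_uniq // iota_uniq.
move=> i; rewrite mem_filter mem_index_iota /=.
by case: (boolP (i \in I)) => // /hI ->.
Qed.

(** Weak duality with the multiplier w gives the upper bound mu.  It is attained
    by x = mu + z with z supported on the nodes: the form [rest] kills w by the
    choice of mu, so interpolation makes [rest] a combination of the values at
    the nodes, and its coefficients are the z_i.  The last hypothesis is
    z_i >= 0, with a quotient turned into a product.  Some index is not a node,
    so mu is a value of x. *)
Lemma moment_lp r lam I (sg : R) :
  let w := sg *: nodepoly I in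
  let d := (size I).+1 in
  let w0 := \sum_(k < r) w.[k%:R] in
  let mu := momfun lam d w / w0 in
  let rest := fun m => lam m - mu * \sum_(k < r) k%:R ^+ m in
  uniq I -> all (fun i => i < r)%N I -> (size I < r)%N ->
  (forall k, (k < r)%N -> 0 <= w.[k%:R]) -> 0 < w0 ->
  (forall i, i \in I ->
     0 <= momfun rest d (nodepoly (rem i I)) * (nodepoly (rem i I)).[i%:R]) ->
  (exists x : 'rV[R]_r, [/\ has_moments d lam x, forall k : 'I_r, mu <= x 0 k
      & exists k : 'I_r, x 0 k = mu])
  /\ (forall (y : 'rV[R]_r) a, has_moments d lam y -> (forall k : 'I_r, a <= y 0 k) -> a <= mu).
Proof.
move=> w d w0 mu rest uI hI sI hw w0_gt0 hz.
have sw : (size w <= d)%N by rewrite (leq_trans (size_scale_leq _ _)) // size_nodepoly.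
split; last first.
  move=> y a hy ha; rewrite ler_pdivlMr // -(has_moments_poly hy) // /w0 mulr_sumr.
  by apply: ler_sum => k _; rewrite mulrC ler_wpM2l // hw.
pose z (k : nat) : R := if k \in I then
  momfun rest d (nodepoly (rem k I)) / (nodepoly (rem k I)).[k%:R] else 0.
have restE p : momfun rest d p = momfun lam d p - mu * momfun (fun m => \sum_(k < r) k%:R ^+ m) d p.
  rewrite /momfun mulr_sumr -sumrB; apply: eq_bigr => m _.
  by rewrite /rest; ring.
have momsum p : (size p <= d)%N ->
    momfun (fun m => \sum_(k < r) k%:R ^+ m) d p = \sum_(k < r) p.[k%:R].
  move=> hp; under [RHS]eq_bigr => k _ do rewrite (horner_coef_wide _ hp).
  by rewrite exchange_big; apply: eq_bigr => m _ /=; rewrite mulr_sumr.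
have sg0 : sg != 0.
  apply: contraTneq w0_gt0 => sg0; rewrite -leNgt /w0 big1 // => k _.
  by rewrite /w sg0 scale0r horner0.
have restw : momfun rest d (nodepoly I) = 0.
  have : momfun rest d w = 0 by rewrite restE momsum // -/w0 /mu divfK ?subrr // gt_eqF.
  by rewrite /w linearZ /= => /eqP; rewrite mulf_eq0 (negbTE sg0) => /eqP.
have restp p : (size p <= d)%N -> momfun rest d p = \sum_(i <- I) p.[i%:R] * z i.
  move=> hp; have [c {1}->] := interpolation uI hp.
  rewrite linearD linearZ /= restw mulr0 addr0 linear_sum big_seq [RHS]big_seq.
  by apply: eq_bigr => i iI; rewrite linearZ /= /z iI mulrAC -mulrA.
exists (\row_k (mu + z k)); split.
- move=> m hm; under eq_bigr => k _ do rewrite mxE mulrDr.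
  rewrite big_split /= -mulr_suml.
  have -> : \sum_(k < r) k%:R ^+ m * z k = momfun rest d 'X^m.
    rewrite restp ?size_polyXn // -(@sum_mem_nodes I r (fun i => 'X^m.[i%:R] * z i)) //.
    rewrite [RHS]big_mkcond /=; apply: eq_bigr => k _.
    by rewrite hornerXn /z; case: ifP => // _; rewrite mulr0.
  by rewrite momfunXn // /rest mulrC addrC subrK.
- move=> k; rewrite mxE lerDl /z; case: ifP => // kI.
  have h := nodepoly_rem uI kI; have := hz _ kI.
  set u := momfun _ _ _; set v := _.[_] in h *.
  have -> : u / v = u * v / v ^+ 2 by field.
  by move=> uv; rewrite divr_ge0 // sqr_ge0.
have [k hk] : exists k : 'I_r, val k \notin I.
  apply/existsP; apply: contraLR sI; rewrite negb_exists -leqNgt => /forallP h.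
  rewrite -[r](size_iota 0); apply: uniq_leq_size; first exact: iota_uniq.
  by move=> k; rewrite mem_iota /= => kr; have := h (Ordinal kr); rewrite negbK.
by exists k; rewrite mxE /z (negbTE hk) addr0.
Qed.

End MomentLP.

Section Infeasible.
Context {R : realType}.

Lemma momfun_norm_moment s r r' d (w : {poly R}) : (r' <= r)%N -> (size w <= d)%N ->
  momfun (norm_moment s r) d w
  = momfun (norm_moment s r') d w + \sum_(r' <= k < r) w.[k%:R].
Proof.
move=> hr hw; under [X in _ + X]eq_bigr => k _ do rewrite (horner_coef_wide _ hw).
rewrite exchange_big /= -big_split /=; apply: eq_bigr => m _.
rewrite -mulr_sumr -mulrDr /norm_moment; congr (_ * _).
rewrite -(big_mkord predT (fun k => k%:R ^+ m)) -(big_mkord predT (fun k => k%:R ^+ m)).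
by rewrite (@big_cat_nat _ _ _ r') //= addrAC.
Qed.

(** Positive weights on r' points, extended by ones, satisfy the moment equations
    of size r: one multiplier w for the size r excludes all smaller sizes. *)
Lemma no_positive_norm s r r' (w : {poly R}) (x : 'rV[R]_r') : (r' <= r)%N ->
  (size w <= 2 * s)%N -> (forall k, (k < r)%N -> 0 <= w.[k%:R]) ->
  momfun (norm_moment s r) (2 * s) w < 0 ->
  has_moments (2 * s) (norm_moment s r') x -> ~ (forall k, 0 < x 0 k).
Proof.
move=> hr sw hw hlt hx x_gt0; move: hlt; rewrite ltNge => /negP; apply.
rewrite (momfun_norm_moment _ hr sw) -(has_moments_poly hx sw) addr_ge0 //.
  by apply: sumr_ge0 => k _; rewrite mulr_ge0 ?(ltW (x_gt0 k)) // hw // (leq_trans (ltn_ord k)).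
by rewrite big_seq sumr_ge0 // => k; rewrite mem_index_iota => /andP[_ /hw].
Qed.

End Infeasible.

(** * Dimensions of the solution sets *)

Section Dimensions.
Context {R : realType}.

Lemma affine_dim_image (V W : vectType R) (f : {linear V -> W}) (A : set W) (x0 : W) :
  injective f -> (forall x, A x <-> exists v, x - x0 = f v) -> affine_dim A (dim V).
Proof.
move=> inj_f hA; exists x0, (limg (linfun f)); split.
  rewrite limg_dim_eq ?dimvf //.
  apply/eqP; rewrite (_ : lker _ = 0%VS) ?capv0 //; apply/eqP/lker0P => u v.
  by rewrite !lfunE => /inj_f.
move=> x; rewrite hA; split=> [[v ->]|/memv_imgP[v _ ->]].
  by rewrite -(lfunE f) memv_img ?memvf.
by exists v; rewrite lfunE.
Qed.

Definition monmx r d : 'M[R]_(r, d) := \matrix_(i, j) i%:R ^+ j.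

(** A vanishing combination of the columns is a polynomial of degree < d with the
    r >= d roots 0, ..., r - 1. *)
Lemma mxrank_monmx r d : (d <= r)%N -> \rank (monmx r d) = d.
Proof.
move=> dr; rewrite -mxrank_tr; apply/eqP; rewrite -[_ == _]/(row_free _); apply: inj_row_free => v hv.
have root_v (k : nat) : (k < r)%N -> (rVpoly v).[k%:R] = 0.
  move=> kr; move/rowP/(_ (Ordinal kr)): hv; rewrite !mxE /= => hk.
  rewrite (horner_coef_wide _ (size_poly _ _)) -[RHS]hk; apply: eq_bigr => j _.
  by rewrite coef_rVpoly_ord !mxE.
apply/(can_inj rVpolyK); rewrite linear0; apply/eqP; apply: contraTT dr => nz.
have := max_poly_roots nz (rs := [seq k%:R | k <- iota 0 r]).
rewrite size_map size_iota -ltnNge => h; apply: (@leq_trans (size (rVpoly v))); last exact: size_poly.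
apply: h.
  by apply/allP => _ /mapP[k + ->]; rewrite mem_iota rootE => /root_v ->.
by rewrite map_inj_uniq ?iota_uniq // => a b /eqP; rewrite eqr_nat => /eqP.
Qed.

Lemma rank_ker_monmx r d : (d <= r)%N -> \rank (kermx (monmx r d)) = (r - d)%N.
Proof. by move=> dr; rewrite mxrank_ker mxrank_monmx. Qed.

Lemma has_moments_mx r d lam (x : 'rV[R]_r) :
  has_moments d lam x <-> x *m monmx r d = \row_(m < d) lam m.
Proof.
split=> h.
  apply/rowP => m; rewrite !mxE -h //.
  by apply: eq_bigr => k _; rewrite mxE mulrC.
move=> m hm; move/rowP/(_ (Ordinal hm)): h; rewrite !mxE /= => <-.
by apply: eq_bigr => k _; rewrite mxE mulrC.
Qed.

Lemma affine_dim_moments r d lam (x0 : 'rV[R]_r) : (d <= r)%N ->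
  has_moments d lam x0 -> affine_dim (has_moments d lam : set 'rV_r) (r - d).
Proof.
move=> dr hx0; set N := row_base (kermx (monmx r d)).
have -> : (r - d)%N = dim 'rV[R]_(\rank (kermx (monmx r d))).
  by rewrite dim_matrix -[RHS]/(1 * _)%N mul1n rank_ker_monmx.
apply: (@affine_dim_image _ _ (mulmxr N) _ x0) => [u v /= /row_free_inj ->|x] //.
  exact: row_base_free.
move/has_moments_mx: hx0 => hx0.
rewrite has_moments_mx; split=> [hx|[v /= hv]].
  have : (x - x0 <= N)%MS by rewrite eq_row_base; apply/sub_kermxP; rewrite mulmxBl hx hx0 subrr.
  by case/submxP => v hv; exists v.
have hN : N *m monmx r d = 0 by apply/sub_kermxP; rewrite eq_row_base.
by apply/eqP; rewrite -hx0 -subr_eq0 -mulmxBl hv -mulmxA hN mulmx0.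
Qed.

Definition upper_idx n := {p : 'I_n * 'I_n | (p.1 < p.2)%N}.

Lemma card_upper_idx n : #|{: upper_idx n}| = 'C(n, 2).
Proof.
rewrite card_sig -sum1_card -bin2_sum big_mkord.
rewrite -(pair_big_dep predT (fun i j : 'I_n => (i < j)%N) (fun _ _ => 1%N)) /=.
rewrite (exchange_big_dep predT) //=; apply: eq_bigr => j _.
by rewrite -(big_ord_widen n (fun _ => 1%N) (ltnW (ltn_ord j))) sum1_card card_ord.
Qed.

(** Zero unless i < j, so that the row vector v lists a strict upper triangle. *)
Definition upper_entry n (v : 'rV[R]_#|{: upper_idx n}|) (i j : 'I_n) : R :=
  if insub (i, j) is Some p then v 0 (enum_rank p) else 0.

Definition skew_of n (v : 'rV[R]_#|{: upper_idx n}|) : 'M[R]_n :=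
  \matrix_(i, j) (upper_entry v i j - upper_entry v j i).

Fact skew_of_is_linear n : linear (@skew_of n).
Proof.
move=> a u v; apply/matrixP => i j; rewrite !mxE /upper_entry.
by case: insub => [p|]; case: insub => [q|]; rewrite ?mxE; ring.
Qed.
HB.instance Definition _ n :=
  GRing.isLinear.Build R _ _ *:%R (@skew_of n) (@skew_of_is_linear n).

Lemma upper_entry_lower n (v : 'rV[R]_#|{: upper_idx n}|) (i j : 'I_n) :
  (j <= i)%N -> upper_entry v i j = 0.
Proof. by rewrite /upper_entry; case: insubP => // p; rewrite /= ltnNge => /negbTE ->. Qed.

Lemma upper_entryE n (v : 'rV[R]_#|{: upper_idx n}|) (p : upper_idx n) :
  upper_entry v (val p).1 (val p).2 = v 0 (enum_rank p).
Proof. by rewrite /upper_entry -surjective_pairing valK. Qed.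

Lemma skew_of_inj n : injective (@skew_of n).
Proof.
move=> u v /matrixP h; apply/rowP => k; rewrite -(enum_valK k).
set p := enum_val k; have hp := valP p.
have := h (val p).1 (val p).2.
by rewrite !mxE !upper_entryE !(upper_entry_lower _ (ltnW hp)) !subr0.
Qed.

Lemma skew_ofP n (S : 'M[R]_n) : S + S^T = 0 <-> exists v, S = skew_of v.
Proof.
split=> [/matrixP hS|[v ->]]; last first.
  by apply/matrixP => i j; rewrite !mxE; ring.
exists (\row_k S (val (enum_val k)).1 (val (enum_val k)).2).
have up (i j : 'I_n) : (i < j)%N ->
    upper_entry (\row_k S (val (enum_val k)).1 (val (enum_val k)).2) i j = S i j.
  by move=> ij; rewrite /upper_entry insubT /= mxE enum_rankK.
apply/matrixP => i j; rewrite mxE; have := hS i j; rewrite !mxE.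
case: (ltngtP i j) => hij.
- by rewrite up // upper_entry_lower ?subr0 // ltnW.
- by rewrite (up j i) // upper_entry_lower ?(ltnW hij) // => h; lra.
- by move/ord_inj: hij => <-; rewrite subrr => h; lra.
Qed.

(** With N a basis of the left kernel of X, a skew matrix killing X has its rows,
    and by skewness its columns, in the span of N: it is N^T S N for a unique
    skew S of size n. *)
Lemma skew_annihilating_dim r d (X : 'M[R]_(r, d)) (A : set 'M[R]_r) (B0 : 'M[R]_r) :
  let n := \rank (kermx X) in
  (forall B, A B <-> (B - B0) + (B - B0)^T = 0 /\ (B - B0) *m X = 0) ->
  affine_dim A 'C(n, 2).
Proof.
move=> n hA.
have [N [freeN NX subN]] : exists N : 'M[R]_(n, r), [/\ row_free N, N *m X = 0
    & forall E : 'M[R]_r, E *m X = 0 -> exists M, E = M *m N].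
  exists (row_base (kermx X)); split; first exact: row_base_free.
    by apply/sub_kermxP; rewrite eq_row_base.
  by move=> E h; apply/submxP; rewrite eq_row_base; apply/sub_kermxP.
pose f (v : 'rV[R]_#|{: upper_idx n}|) : 'M[R]_r := N^T *m skew_of v *m N.
have f_lin : linear f by move=> a u v; rewrite /f linearP mulmxDr mulmxDl -scalemxAr -scalemxAl.
pose fL := GRing.isLinear.Build R _ _ *:%R f f_lin.
pose F : {linear 'rV[R]_#|{: upper_idx n}| -> 'M[R]_r} := HB.pack f fL.
have congN (S : 'M_n) : N^T *m S *m N = 0 -> S = 0.
  move=> h; apply: (row_free_inj freeN); rewrite mul0mx; apply: trmx_inj.
  apply: (row_free_inj freeN); rewrite trmx0 mul0mx; apply: trmx_inj.
  by rewrite trmx0 trmx_mul trmxK mulmxA.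
have -> : 'C(n, 2) = dim 'rV[R]_#|{: upper_idx n}|.
  by rewrite dim_matrix -[RHS]/(1 * _)%N mul1n card_upper_idx.
apply: (@affine_dim_image _ _ F _ B0) => [u v /= huv|B].
  apply: skew_of_inj; apply/eqP; rewrite -subr_eq0; apply/eqP; apply: congN.
  by rewrite mulmxBr mulmxBl -/(f u) -/(f v) huv subrr.
rewrite hA; split=> [[]|[v ->]]; last first.
  split; last by rewrite /= /f -mulmxA NX mulmx0.
  have hS : skew_of v + (skew_of v)^T = 0 by apply/skew_ofP; exists v.
  have trf : (f v)^T = N^T *m (skew_of v)^T *m N by rewrite !trmx_mul trmxK mulmxA.
  by rewrite -[F v]/(f v) trf -mulmxDl -mulmxDr hS mulmx0 mul0mx.
set D := B - B0 => skD DX.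
have DT : D^T = - D by apply/eqP; rewrite -addr_eq0 addrC skD.
have [M hM] := subN _ DX.
have [K NK] : exists K, N *m K = 1%:M by exact/row_freeP.
have hMT : D = N^T *m (- M^T) by rewrite mulmxN -trmx_mul -hM DT opprK.
have hD : D = N^T *m (- M^T *m K) *m N.
  by rewrite !mulmxA -hMT [in RHS]hM -(mulmxA M) NK mulmx1.
suff /skew_ofP[v hv] : (- M^T *m K) + (- M^T *m K)^T = 0 by exists v; rewrite /= /f -hv.
have trD : N^T *m (- M^T *m K)^T *m N = D^T by rewrite [in RHS]hD !trmx_mul trmxK !mulmxA.
by apply: congN; rewrite mulmxDr mulmxDl -hD trD.
Qed.

End Dimensions.

(** * The boundary block *)

(** Subtracting E / 2 reduces to finding a skew A with A X = Z, where X^T Z is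
    skew.  With a left inverse K of X,
    A = Z K - K^T Z^T + K^T Z^T X K is such a matrix. *)
Lemma symmetric_part_solvable (R : numFieldType) r d (X W : 'M[R]_(r, d)) (E : 'M[R]_r) :
  (exists K : 'M[R]_(d, r), K *m X = 1%:M) -> E^T = E ->
  X^T *m W + (X^T *m W)^T = - (X^T *m E *m X) ->
  exists B, B + B^T = - E /\ B *m X = W.
Proof.
move=> [K KX] ET hW.
have trD m n (U V : 'M[R]_(m, n)) : (U + V)^T = U^T + V^T by rewrite linearD.
have trZ m n a (U : 'M[R]_(m, n)) : (a *: U)^T = a *: U^T by rewrite linearZ.
have trN m n (U : 'M[R]_(m, n)) : (- U)^T = - U^T by rewrite linearN.
have half1 : 2%:R^-1 + 2%:R^-1 = 1 :> R by field.
have [Z [ZE hZ]] : exists Z, Z = W + 2%:R^-1 *: (E *m X) /\ X^T *m Z + Z^T *m X = 0.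
  exists (W + 2%:R^-1 *: (E *m X)); split=> //; set Z := W + _.
  have -> : Z^T *m X = (X^T *m Z)^T by rewrite trmx_mul trmxK.
  have EXT : (X^T *m E *m X)^T = X^T *m E *m X by rewrite !trmx_mul trmxK ET mulmxA.
  rewrite /Z mulmxDr trD addrACA hW -scalemxAr trZ mulmxA EXT -scalerDl half1.
  by rewrite scale1r addNr.
pose A := Z *m K - K^T *m Z^T + K^T *m (Z^T *m X) *m K.
have AX : A *m X = Z.
  rewrite /A !(mulmxDl, mulNmx) -[Z *m K *m X]mulmxA KX mulmx1.
  by rewrite -[_ *m K *m X]mulmxA KX mulmx1 mulmxA subrK.
have AT : A + A^T = 0.
  have e : (K^T *m (Z^T *m X) *m K)^T = - (K^T *m (Z^T *m X) *m K).
    apply/eqP; rewrite -addr_eq0 !trmx_mul !trmxK [K^T *m (_ *m K)]mulmxA.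
    by rewrite -mulmxDl -mulmxDr hZ mulmx0 mul0mx.
  rewrite /A !trD trN e !trmx_mul !trmxK.
  by rewrite addrACA subrr addr0 addrC -opprB addNr.
exists (A - 2%:R^-1 *: E); split; last by rewrite mulmxBl AX ZE -scalemxAl addrK.
by rewrite trD trN trZ ET addrACA AT add0r -opprD -scalerDl half1 scale1r.
Qed.

Section Boundary.
Context {R : realType}.
Variables (s t r : nat).
Hypothesis r_gt0 : (0 < r)%N.

Let X : 'M[R]_(r, t.+1) := \matrix_(i, j) i%:R ^+ j.
Let Xt : 'M[R]_(s, t.+1) := \matrix_(i, j) (r + i)%:R ^+ j.
Let Y : 'M[R]_(r, t.+1) := \matrix_(i, j) dmon j i.
Let E : 'M[R]_r := canvec r 0 *m (canvec r 0)^T.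

(** The entry (p, q) of this symmetric matrix identity is the norm condition for
    (p, q). *)
Lemma normset_mx (x : 'rV[R]_r) (M := X^T *m (diag_mx x *m Y - stencilC s r *m Xt)) :
  normset s t r x <-> M + M^T = - (X^T *m E *m X).
Proof.
have EX p q : (X^T *m E *m X) p q = (p == 0 :> nat)%:R * (q == 0 :> nat)%:R.
  rewrite /E mulmxA -mulmxA mxE big_ord1 !mxE.
  congr (_ * _); rewrite (bigD1 (Ordinal r_gt0)) //= big1 ?addr0.
  - by rewrite !mxE eqxx mulr1 expr0n.
  - by move=> k /negPf hk; rewrite !mxE -val_eqE /= in hk *; rewrite hk mulr0.
  - by rewrite !mxE eqxx mul1r expr0n.
  - by move=> k /negPf hk; rewrite !mxE -val_eqE /= in hk *; rewrite hk mul0r.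
have ME p q : M p q = \sum_(k < r) k%:R ^+ p * (x 0 k * dmon q k)
   - \sum_(k < r) \sum_(l < s) k%:R ^+ p * (r + l)%:R ^+ q * stencilC s r k l.
  rewrite /M mulmxBr mxE [X in _ + X]mxE; congr (_ - _).
    by rewrite mxE; apply: eq_bigr => k _; rewrite mul_diag_mx !mxE.
  rewrite mxE; apply: eq_bigr => k _; rewrite !mxE mulr_sumr; apply: eq_bigr => l _.
  by rewrite !mxE; ring.
have dmonD p q k : k%:R ^+ p * dmon q k + k%:R ^+ q * dmon p k = dmon (p + q) k :> R.
  rewrite /dmon; case: p => [|p]; case: q => [|q] /=;
    rewrite ?add0n ?addn0 ?mul0r ?mulr0 ?addr0 ?add0r ?expr0 ?mul1r //.
  by rewrite natrD addnS !exprS !exprD; ring.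
have key (p q : 'I_t.+1) : (M + M^T) p q = - (X^T *m E *m X) p q <->
   \sum_(k < r) dmon (p + q) k * x 0 k
     = \sum_(k < r) \sum_(l < s)
         (k%:R ^+ p * (r + l)%:R ^+ q + k%:R ^+ q * (r + l)%:R ^+ p)
         * stencilC s r k l
       - (p == 0 :> nat)%:R * (q == 0 :> nat)%:R.
  rewrite EX mxE [M^T _ _]mxE !ME.
  have -> : \sum_(k < r) dmon (p + q) k * x 0 k =
    \sum_(k < r) k%:R ^+ p * (x 0 k * dmon q k) + \sum_(k < r) k%:R ^+ q * (x 0 k * dmon p k).
    by rewrite -big_split; apply: eq_bigr => k _ /=; rewrite -dmonD; ring.
  have -> : \sum_(k < r) \sum_(l < s)
      (k%:R ^+ p * (r + l)%:R ^+ q + k%:R ^+ q * (r + l)%:R ^+ p) * stencilC s r k l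
    = \sum_(k < r) \sum_(l < s) k%:R ^+ p * (r + l)%:R ^+ q * stencilC s r k l
    + \sum_(k < r) \sum_(l < s) k%:R ^+ q * (r + l)%:R ^+ p * stencilC s r k l :> R.
    rewrite -big_split; apply: eq_bigr => k _; rewrite -big_split; apply: eq_bigr => l _ /=.
    by rewrite mulrDl.
  by split=> h; lra.
split=> [h|/matrixP h p q pq qt].
  apply/matrixP => p q; rewrite [RHS]mxE.
  wlog pq : p q / (p <= q)%N => [hw|].
    case/orP: (leq_total p q) => pq; first exact: hw.
    have := hw q p pq; rewrite !EX [X in _ = - X -> _]mulrC => <-.
    by rewrite [LHS]mxE [RHS]mxE ![M^T _ _]mxE addrC.
  by apply/key/h => //; rewrite -ltnS.
have pt : (p < t.+1)%N by rewrite ltnS (leq_trans pq).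
have := h (Ordinal pt) (Ordinal (qt : (q < t.+1)%N)); rewrite [RHS]mxE.
by move/key.
Qed.

Lemma boundaryset_mx (x : 'rV[R]_r) B : boundaryset s t x B <->
  B + B^T = - E /\ B *m X = diag_mx x *m Y - stencilC s r *m Xt.
Proof.
rewrite /boundaryset /=; split=> -[h1 h2]; split=> //.
  by rewrite -h2 addrK.
by rewrite h2 subrK.
Qed.

Lemma boundary_normset (x : 'rV[R]_r) B : boundaryset s t x B -> normset s t r x.
Proof.
case/boundaryset_mx => h1 h2; apply/normset_mx; rewrite -h2.
rewrite !trmx_mul trmxK !mulmxA -mulmxDl -mulmxDr h1.
by rewrite mulmxN mulNmx /E !mulmxA.
Qed.

Lemma boundaryset_exists (x : 'rV[R]_r) : (t < r)%N -> normset s t r x ->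
  exists B, boundaryset s t x B.
Proof.
move=> tr /normset_mx hW.
have ET : E^T = E by rewrite /E trmx_mul trmxK.
have [|B hB] := symmetric_part_solvable _ ET hW.
  by apply/row_fullP; rewrite /row_full -[X]/(monmx r t.+1) mxrank_monmx.
by exists B; apply/boundaryset_mx.
Qed.

Lemma boundaryset_dim (x : 'rV[R]_r) : (t < r)%N -> normset s t r x ->
  affine_dim (boundaryset s t x) 'C(r - t.+1, 2).
Proof.
move=> tr hx; have [B0 hB0] := boundaryset_exists tr hx.
rewrite -(@rank_ker_monmx R) //.
apply: (@skew_annihilating_dim _ _ _ _ _ B0) => B.
move/boundaryset_mx: hB0 => [h1 h2].
split=> [/boundaryset_mx[g1 g2]|[g1 g2]].
  split; last by rewrite mulmxBl -[monmx _ _]/X h2 g2 subrr.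
  by rewrite linearB /= addrACA -opprD g1 h1 subrr.
apply/boundaryset_mx; split.
  by apply/eqP; rewrite -subr_eq0 -h1 opprD addrACA -linearB /= g1.
by apply/eqP; rewrite -subr_eq0 -h2 -mulmxBl g2.
Qed.

End Boundary.

(** * From the boundary block to the full operator *)

Section NatMatrix.
Context {R : realType}.
Implicit Types F G : nat -> nat -> R.

(** Matrices given by functions on nat, for which casts and block decompositions
    are mere shifts of the indices. *)
Definition nmx m n F : 'M[R]_(m, n) := \matrix_(i, j) F i j.

Lemma castmx_nmx m n m' n' (em : m = m') (en : n = n') F :
  castmx (em, en) (nmx m n F) = nmx m' n' F.
Proof. by case: _ / em; case: _ / en; rewrite castmx_id. Qed.

Lemma nmx_row m n1 n2 F :
  nmx m (n1 + n2) F = row_mx (nmx m n1 F) (nmx m n2 (fun i j => F i (n1 + j)%N)).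
Proof. by apply/matrixP => i j; rewrite !mxE; case: splitP => k ek; rewrite !mxE ek. Qed.

Lemma nmx_col m1 m2 n F :
  nmx (m1 + m2) n F = col_mx (nmx m1 n F) (nmx m2 n (fun i j => F (m1 + i)%N j)).
Proof. by apply/matrixP => i j; rewrite !mxE; case: splitP => k ek; rewrite !mxE ek. Qed.

Lemma nmx_block m1 m2 n1 n2 F :
  nmx (m1 + m2) (n1 + n2) F =
  block_mx (nmx m1 n1 F) (nmx m1 n2 (fun i j => F i (n1 + j)%N))
           (nmx m2 n1 (fun i j => F (m1 + i)%N j)) (nmx m2 n2 (fun i j => F (m1 + i)%N (n1 + j)%N)).
Proof. by rewrite nmx_col !nmx_row block_mxEv. Qed.

Definition dnmx n (d : nat -> R) : 'M[R]_n := nmx n n (fun i j => (i == j)%:R * d i).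

Lemma mul_dnmx n (d : nat -> R) F : dnmx n d *m nmx n n F = nmx n n (fun i j => d i * F i j).
Proof.
apply/matrixP => i j; rewrite !mxE (bigD1 i) //= big1 ?addr0; first by rewrite !mxE eqxx mul1r.
by move=> k /negbTE ki; rewrite !mxE [(_ == _)](_ : _ = false) ?mul0r // eq_sym.
Qed.

Lemma invmx_dnmx n (d : nat -> R) : (forall i, (i < n)%N -> d i != 0) ->
  invmx (dnmx n d) = dnmx n (fun i => (d i)^-1).
Proof.
move=> hd.
have h : dnmx n d *m dnmx n (fun i => (d i)^-1) = 1%:M.
  rewrite mul_dnmx; apply/matrixP => i j; rewrite !mxE -val_eqE /=.
  by case: eqP => _; rewrite ?mul0r ?mulr0 ?mul1r ?mulfV ?hd.
have [u _] := mulmx1_unit h.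
by rewrite -[RHS]mul1mx -(mulVmx u) -mulmxA h mulmx1.
Qed.

Lemma dnmx_block n1 n2 (d : nat -> R) :
  dnmx (n1 + n2) d = block_mx (dnmx n1 d) 0 0 (dnmx n2 (fun i => d (n1 + i)%N)).
Proof.
rewrite /dnmx nmx_block; congr block_mx; apply/matrixP => i j; rewrite !mxE.
- by rewrite (_ : (_ == _) = false) ?mul0r //; have := ltn_ord i; lia.
- by rewrite (_ : (_ == _) = false) ?mul0r //; have := ltn_ord j; lia.
- by rewrite eqn_add2l.
Qed.

Lemma dnmx_posdef n (d : nat -> R) : (forall i, (i < n)%N -> 0 < d i) -> posdefmx (dnmx n d).
Proof.
move=> hd; split.
  apply/matrixP => i j; rewrite !mxE; have [->|ij] := eqVneq (i : nat) j; first by [].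
  by rewrite !mul0r.
move=> x x0.
have -> : (x *m dnmx n d *m x^T) 0 0 = \sum_(i < n) d i * x 0 i ^+ 2.
  rewrite mxE; apply: eq_bigr => i _; rewrite !mxE (bigD1 i) //= big1 ?addr0.
    by rewrite !mxE eqxx mul1r; ring.
  by move=> k /negbTE ki; rewrite !mxE [(_ == _)](_ : _ = false) ?mul0r ?mulr0.
have [i xi] : exists i, x 0 i != 0.
  apply/existsP; apply: contraNT x0; rewrite negb_exists => /forallP h.
  by apply/eqP/rowP => i; rewrite mxE; apply/eqP; rewrite -[_ == _]negbK h.
rewrite (bigD1 i) //= ltr_wpDr //.
  by apply: sumr_ge0 => k _; rewrite mulr_ge0 ?sqr_ge0 // ltW // hd.
by rewrite mulr_gt0 ?hd // lt_def sqr_ge0 sqrf_eq0 xi.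
Qed.

Lemma dnmx_diag n (d : nat -> R) : is_diag_mx (dnmx n d).
Proof.
by apply/is_diag_mxP => i j ij; rewrite mxE (_ : (_ == _) = false) ?mul0r //; apply/negbTE.
Qed.

Lemma posdef_diag_gt0 n (A : 'M[R]_n) i : posdefmx A -> 0 < A i i.
Proof.
case=> _ /(_ (delta_mx 0 i)).
rewrite -rowE trmx_delta -colE !mxE; apply.
by apply/eqP => /rowP/(_ i)/eqP; rewrite !mxE !eqxx oner_eq0.
Qed.

Lemma castmx_mul n n' (e : n = n') (A B : 'M[R]_n) :
  castmx (e, e) A *m castmx (e, e) B = castmx (e, e) (A *m B).
Proof. by case: _ / e; rewrite !castmx_id. Qed.

End NatMatrix.

Section Extract.
Context {R : realType}.

(** Only the first r rows matter: multiplied by P, they are [B C0 0]. *)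
Lemma sbp_boundary s t r n (hn : (2 * r + s <= n)%N) (P D : 'M[R]_n) :
  (0 < r)%N -> is_sbp s t r hn P D ->
  exists2 x : 'rV[R]_r, (forall k, 0 < x 0 k) & exists B, boundaryset s t x B.
Proof.
move=> r0 [Pt [Ph [[dPt pPt dPh pPh EP] _ acc energy [B [Bh [Ch [Dt /= ED]]]]]]].
move: (sbp_size s r n hn) (sbp_interior s r n hn) EP ED => e hs EP ED.
exists (\row_k Pt k k) => [k|]; first by rewrite mxE posdef_diag_gt0.
have EPt : Pt = diag_mx (\row_k Pt k k).
  apply/matrixP => i j; rewrite !mxE; case: eqP => [->|/eqP ij]; first by rewrite mulr1n.
  by rewrite mulr0n; move/is_diag_mxP: dPt; apply.
have uPt : Pt \in unitmx.
  rewrite EPt unitmxE det_diag unitfE; apply/prodf_neq0 => k _.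
  by rewrite mxE gt_eqF // posdef_diag_gt0.
exists B.
set m := (n - 2 * r)%N in e hs Dt EP ED *.
move: ED; set C0 : 'M[R]_(r, m) := castmx (erefl r, _) _ => ED.
pose U : 'M[R]_(r, r + (m + r)) := row_mx B (row_mx C0 0).
have [L DE] : exists L : 'M[R]_(m + r, r + (m + r)), D = castmx (e, e) (col_mx (invmx Pt *m U) L).
  by rewrite ED mulmx_block !mul0mx !addr0 block_mxEv -mul_mx_row; eexists.
have [L' PDE] : exists L' : 'M[R]_(m + r, r + (m + r)), P *m D = castmx (e, e) (col_mx U L').
  rewrite EP DE castmx_mul mul_block_col mul0mx addr0 mulmxA mulmxV // mul1mx mul0mx add0r.
  by eexists.
pose top (i : 'I_r) : 'I_n := cast_ord e (lshift _ i).
have Dtop i j : Pt i i * D (top i) (cast_ord e j) = U i j.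
  rewrite DE castmxE !cast_ordK col_mxEu.
  have -> : U i j = (Pt *m (invmx Pt *m U)) i j by rewrite mulmxA mulmxV // mul1mx.
  move: (invmx Pt *m U) => V; rewrite [in RHS]EPt mul_diag_mx !mxE //.
have PDtop i j : (P *m D) (top i) (cast_ord e j) = U i j.
  by rewrite PDE castmxE !cast_ordK col_mxEu.
have PT : P^T = P.
  rewrite EP trmx_cast /= !tr_block_mx !trmx0 trmx1.
  by rewrite (proj1 pPt) (proj1 pPh).
apply/boundaryset_mx => //; split.
  have : P *m D + (P *m D)^T = canvec n n.-1 *m (canvec n n.-1)^T - canvec n 0 *m (canvec n 0)^T.
    by rewrite trmx_mul PT.
  move/matrixP => h; apply/matrixP => i j; have := h (top i) (top j).
  rewrite mxE [X in _ + X]mxE !PDtop !row_mxEl => h'.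
  rewrite mxE [X in _ + X]mxE h'.
  rewrite !mxE !big_ord1 !mxE /= (_ : (_ == n.-1) = false) ?mul0r ?sub0r //.
  by apply/negbTE; have := ltn_ord i; lia.
apply/matrixP => i k.
have hi : (top i < r)%N || (n - r <= top i)%N by rewrite /= ltn_ord.
have hk : (k <= t)%N by rewrite -ltnS.
have /(congr1 ( *%R (Pt i i))) := acc (top i) k hi hk.
rewrite mulr_sumr (reindex (cast_ord e)) /=; last first.
  by exists (cast_ord (esym e)) => l _; rewrite ?cast_ordK ?cast_ordKV.
under eq_bigr => l _ do rewrite mulrA Dtop.
rewrite big_split_ord /=.
under eq_bigr => l _ do rewrite row_mxEl.
under [X in _ + X]eq_bigr => l _ do rewrite row_mxEr.
rewrite big_split_ord /= [X in _ + (_ + X)]big1 ?addr0; last first.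
  by move=> l _; rewrite row_mxEr mxE mul0r.
under [X in _ + X]eq_bigr => l _ do rewrite row_mxEl.
rewrite (reindex (cast_ord (subnKC hs))) /=; last first.
  by exists (cast_ord (esym (subnKC hs))) => l _; rewrite ?cast_ordK ?cast_ordKV.
under [X in _ + X]eq_bigr => l _ do rewrite castmxE cast_ordK cast_ord_id.
rewrite big_split_ord /= [X in _ + (_ + X)]big1 ?addr0; last first.
  by move=> l _; rewrite row_mxEr mxE mul0r.
under [X in _ + X]eq_bigr => l _ do rewrite row_mxEl.
move=> h; rewrite mul_diag_mx !mxE -h.
have -> : \sum_(l < r) B i l * (\matrix_(i0, j0) i0%:R ^+ j0 : 'M_(r, t.+1)) l k
    = \sum_(l < r) B i l * l%:R ^+ k by apply: eq_bigr => l _; rewrite mxE.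
have -> : \sum_(l < s) stencilC s r i l * (\matrix_(i0, j0) (r + i0)%:R ^+ j0 : 'M_(s, t.+1)) l k
    = \sum_(l < s) stencilC s r i l * (r + l)%:R ^+ k :> R.
  by apply: eq_bigr => l _; rewrite [in LHS](mxE _ _ l k).
by rewrite addrK.
Qed.

End Extract.

Section Assemble.
Context {R : realType}.
Variables (s t r : nat) (x : 'rV[R]_r) (B : 'M[R]_r).
Hypotheses (r_gt0 : (0 < r)%N) (x_gt0 : forall k, 0 < x 0 k)
  (hB : boundaryset s t x B).
Variable n : nat.
Hypothesis hn : (2 * r + s <= n)%N.

Let idx (i : nat) : 'I_r := insubd (Ordinal r_gt0) i.

Let idxE i : (i < r)%N -> idx i = i :> nat.
Proof. by move=> ir; rewrite -[LHS]/(val _) val_insubd ir. Qed.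

Let idxK (i : 'I_r) : idx i = i.
Proof. exact: valKd. Qed.

Definition stencil_entry (i j : nat) : R :=
  if (i < j <= i + s)%N then alpha s (j - i)
  else if (j < i <= j + s)%N then - alpha s (i - j) else 0.

Let stencil_entry_anti i j : stencil_entry j i = - stencil_entry i j.
Proof.
rewrite /stencil_entry; do ![case: ifP]; rewrite ?opprK ?oppr0 //; lia.
Qed.

(* The entries of P D: the block B at the top, the interior stencil, and at the
   bottom the image of B under i |-> n - 1 - i.  This reflection reverses the
   sign of a first derivative, hence the minus sign. *)
Let q (i j : nat) : R :=
  if (i < r)%N && (j < r)%N then B (idx i) (idx j)
  else if (n - r <= i)%N && (n - r <= j)%N then - B (idx (n.-1 - i)) (idx (n.-1 - j))
  else stencil_entry i j.

Let B_sym (i j : 'I_r) : B i j + B j i = - ((i == 0%N :> nat)%:R * (j == 0%N :> nat)%:R).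
Proof.
have [/matrixP/(_ i j) + _] := hB.
by rewrite mxE [X in _ + X]mxE => ->; rewrite !mxE big_ord1 !mxE.
Qed.

(* The diagonal of P. *)
Let w (i : nat) : R :=
  if (i < r)%N then x 0 (idx i) else if (n - r <= i)%N then x 0 (idx (n.-1 - i)) else 1.

Let w_gt0 i : 0 < w i.
Proof. by rewrite /w; case: ifP => // _; case: ifP. Qed.

Let q_rev i j : (i < n)%N -> (j < n)%N -> q (n.-1 - i) (n.-1 - j) = - q i j.
Proof.
move=> hi hj; have e1 : (n.-1 - (n.-1 - i) = i)%N by lia.
have e2 : (n.-1 - (n.-1 - j) = j)%N by lia.
have top k : (k < n)%N -> (n.-1 - k < r)%N = (n - r <= k)%N by lia.
have bot k : (k < n)%N -> (n - r <= n.-1 - k)%N = (k < r)%N by lia.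
have -> : q i j = if (n - r <= i)%N && (n - r <= j)%N
    then - B (idx (n.-1 - i)) (idx (n.-1 - j))
    else if (i < r)%N && (j < r)%N then B (idx i) (idx j) else stencil_entry i j.
  by rewrite /q; case: ifP => // /andP[ir jr]; rewrite (_ : (n - r <= i)%N = false) //; lia.
rewrite /q !top // !bot // e1 e2; case: ifP => _; first by rewrite opprK.
case: ifP => _ //; rewrite -stencil_entry_anti /stencil_entry.
have -> : (n.-1 - i < n.-1 - j <= n.-1 - i + s)%N = (j < i <= j + s)%N by lia.
have -> : (n.-1 - j < n.-1 - i <= n.-1 - j + s)%N = (i < j <= i + s)%N by lia.
have -> : (n.-1 - j - (n.-1 - i) = i - j)%N by lia.
by have -> : (n.-1 - i - (n.-1 - j) = j - i)%N by lia.
Qed.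

Let w_rev i : (i < n)%N -> w (n.-1 - i) = w i.
Proof.
move=> hi; rewrite /w.
have e1 : (n.-1 - (n.-1 - i) = i)%N by lia.
by rewrite e1; do ![case: ifP] => //; lia.
Qed.

Let q_top (i : 'I_r) (g : nat -> R) :
  \sum_(j < n) q i j * g j =
  \sum_(j < r) B i j * g j + \sum_(l < s) stencilC s r i l * g (r + l)%N.
Proof.
have hi := ltn_ord i.
rewrite -(big_mkord predT (fun j => q i j * g j)) (@big_cat_nat _ _ _ r) //=; last by lia.
rewrite (@big_cat_nat _ _ _ (r + s) r) /=; [|lia|lia].
rewrite [X in _ + (_ + X)]big_nat_cond [X in _ + (_ + X)]big1 ?addr0; last first.
  move=> j hj; rewrite /q /stencil_entry; do ![case: ifP]; rewrite ?mul0r //; lia.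
rewrite big_mkord; congr (_ + _).
  by apply: eq_bigr => j _; rewrite /q hi ltn_ord /= !idxK.
transitivity (\sum_(0 + r <= j < s + r) q i j * g j); first by rewrite add0n addnC.
rewrite big_addn addnK big_mkord; apply: eq_bigr => l _; have hl := ltn_ord l.
rewrite mxE /q /stencil_entry (addnC l r); do ![case: ifP]; rewrite ?mul0r //; lia.
Qed.

Let q_top_poly (i : 'I_r) (p : {poly R}) : (size p <= t.+1)%N ->
  \sum_(j < n) q i j * p.[j%:R] = x 0 i * p^`().[i%:R].
Proof.
move=> sp.
have mon (k : nat) : (k <= t)%N -> \sum_(j < n) q i j * j%:R ^+ k = x 0 i * dmon k i.
  move=> kt; rewrite (q_top i (fun j => j%:R ^+ k)).
  have [_ /matrixP/(_ i (Ordinal (kt : (k < t.+1)%N)))] := hB.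
  rewrite mul_diag_mx mxE [X in X + _]mxE [X in _ + X]mxE !mxE => <-.
  by congr (_ + _); apply: eq_bigr => j _; rewrite [in RHS](mxE _ _ j).
have -> : x 0 i * p^`().[i%:R] = \sum_(k < t.+1) p`_k * (x 0 i * dmon k i).
  have {1}-> : p = \poly_(k < t.+1) p`_k.
    by apply/polyP => k; rewrite coef_poly; case: ltnP => // tk; rewrite nth_default // (leq_trans sp).
  rewrite poly_def linear_sum /= horner_sum mulr_sumr; apply: eq_bigr => k _.
  by rewrite linearZ /= derivXn hornerZ hornerMn hornerXn mulrCA /dmon mulr_natl.
under eq_bigr => j _ do rewrite (horner_coef_wide _ sp) mulr_sumr.
rewrite exchange_big; apply: eq_bigr => k _ /=; rewrite -mon -1?ltnS // mulr_sumr.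
by apply: eq_bigr => j _; rewrite mulrCA.
Qed.

Let q_exact i k : (i < n)%N -> (i < r)%N || (n - r <= i)%N -> (k <= t)%N ->
  \sum_(j < n) q i j * j%:R ^+ k = w i * dmon k i.
Proof.
move=> hi; case: (ltnP i r) => ir /= hi' kt.
  have := @q_top_poly (Ordinal ir) 'X^k; rewrite size_polyXn => /(_ kt) /=.
  under eq_bigr => j _ do rewrite hornerXn.
  move=> ->; rewrite /w ir derivXn hornerMn hornerXn /dmon mulr_natl; congr (x _ _ * _).
  by apply: ord_inj; rewrite idxE.
have jr : (n.-1 - i < r)%N by lia.
have n0 : (0 < n)%N by lia.
have := @q_top_poly (Ordinal jr) ((n.-1%:R%:P - 'X) ^+ k).
have sz : (size ((n.-1%:R%:P - 'X : {poly R}) ^+ k) <= t.+1)%N.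
  rewrite -opprB exprNn -signr_odd; case: (odd k); rewrite ?expr0 ?expr1 ?mulN1r ?mul1r ?size_polyN;
  by rewrite size_exp_XsubC.
move=> /(_ sz).
have nB j : (j < n)%N -> n.-1%:R - j%:R = (n.-1 - j)%:R :> R by move=> hj; rewrite natrB //; lia.
have evB (l m : nat) : (l < n)%N -> ((n.-1%:R%:P - 'X : {poly R}) ^+ m).[l%:R] = (n.-1 - l)%:R ^+ m.
  by move=> ln; rewrite horner_exp hornerD hornerN hornerC hornerX nB.
rewrite deriv_exp linearB /= derivC derivX sub0r hornerMn hornerM hornerN hornerC.
rewrite evB; last by lia.
have e1 : (n.-1 - (n.-1 - i) = i)%N by lia.
rewrite e1 mulN1r => h.
have wi : w i = x 0 (Ordinal jr).
  by rewrite -w_rev // /w jr; congr (x _ _); apply: ord_inj; rewrite idxE.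
rewrite wi /dmon mulr_natl -[RHS]opprK -mulrN -mulNrn -h.
rewrite (reindex_inj rev_ord_inj) -sumrN; apply: eq_bigr => j _.
have hj := ltn_ord j.
rewrite evB // -mulNr -q_rev /=; [|lia|lia].
have -> : (n - j.+1 = n.-1 - j)%N by lia.
by rewrite e1.
Qed.

(** The bottom rows inherit their accuracy from the top rows, applied to the
    polynomial (n - 1 - X)^k instead of X^k. *)
Lemma sbp_of_boundary : exists P D : 'M[R]_n, is_sbp s t r hn P D.
Proof.
exists (dnmx n w), (nmx n n (fun i j => (w i)^-1 * q i j)).
have w_neq0 i : w i != 0 by rewrite gt_eqF.
rewrite /is_sbp; move: (sbp_size s r n hn) (sbp_interior s r n hn).
have En : (r + (n - 2 * r + r) = n)%N by exact: (sbp_size s).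
set m := (n - 2 * r)%N in En * => e hs.
have wm j : (j < m)%N -> w (r + j) = 1.
  by move=> jm; rewrite /w; do ![case: ifP] => //; lia.
pose wh j := w (r + (m + j)).
have eP (v : R -> R) : v 1 = 1 -> dnmx n (fun i => v (w i)) = castmx (e, e)
    (block_mx (dnmx r (fun i => v (w i))) 0 0 (block_mx 1%:M 0 0 (dnmx r (fun i => v (wh i))))).
  move=> v1; rewrite {1}/dnmx -(castmx_nmx e e) -/(dnmx _ _) !dnmx_block; congr castmx.
  congr block_mx; congr block_mx.
  apply/matrixP => i j; rewrite !mxE wm // v1 mulr1 //.
exists (dnmx r w), (dnmx r wh); split.
- split; [exact: dnmx_diag | | exact: dnmx_diag | |];
    try by apply: dnmx_posdef => i _; exact: w_gt0.
  exact: (eP id).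
- move=> i j hi; rewrite mxE /w /q /stencil_entry.
  have -> : (i < r)%N = false by lia.
  have -> : (n - r <= i)%N = false by lia.
  by rewrite invr1 mul1r.
- move=> i k hi kt.
  under eq_bigr => j _ do rewrite mxE -mulrA.
  by rewrite -mulr_sumr q_exact // mulKf.
- have -> : (nmx n n (fun i j => (w i)^-1 * q i j))^T *m dnmx n w
      = (dnmx n w *m nmx n n (fun i j => (w i)^-1 * q i j))^T.
    by rewrite trmx_mul (proj1 (dnmx_posdef (n := n) (fun i _ => w_gt0 i))).
  rewrite mul_dnmx; apply/matrixP => i j; rewrite !mxE !big_ord1 !mxE !mulVKf ?mulKVf //.
  have hi := ltn_ord i; have hj := ltn_ord j.
  rewrite /q [(j < r)%N && _]andbC [(n - r <= j)%N && _]andbC.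
  case: ifP => [/andP[ir jr]|top].
    rewrite B_sym !idxE // (_ : (_ == n.-1) = false) ?mul0r ?sub0r //.
    by apply/negbTE; lia.
  case: ifP => [/andP[ir jr]|bot].
    rewrite -opprD B_sym opprK !idxE; [|lia|lia].
    have -> : (n.-1 - i == 0)%N = (i == n.-1 :> nat) by lia.
    have -> : (n.-1 - j == 0)%N = (j == n.-1 :> nat) by lia.
    by rewrite (_ : (i == 0%N :> nat) = false) ?mul0r ?subr0 //; lia.
  rewrite (stencil_entry_anti i j) subrr -!natrM !mulnb.
  have -> : (i == n.-1 :> nat) && (j == n.-1 :> nat) = false by lia.
  have -> : (i == 0%N :> nat) && (j == 0%N :> nat) = false by lia.
  by rewrite subrr.
exists B, (nmx r r (fun i j => q (r + (m + i)) (r + (m + j)))),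
  (nmx r s (fun i j => q (r + (m + i)) (r + (m - s + j)))),
  (nmx m m (fun i j => q (r + i) (r + j))).
rewrite /= !invmx_dnmx; try by move=> i _; exact: w_neq0.
rewrite -castmx_mul -(eP (fun z => z^-1)) ?invr1 // -mul_dnmx; congr (_ *m _).
have topE : castmx (erefl r, subnKC hs) (row_mx (stencilC s r) 0)
    = nmx r m (fun i j => q i (r + j)).
  rewrite -(castmx_nmx (erefl r) (subnKC hs)) nmx_row; congr castmx; congr row_mx;
    apply/matrixP => i l; rewrite !mxE /q /stencil_entry;
    have hi := ltn_ord i; have hl := ltn_ord l; do ![case: ifP] => //; try lia.
have botE : castmx (erefl r, subnK hs)
    (row_mx 0 (nmx r s (fun i j => q (r + (m + i)) (r + (m - s + j)))))
    = nmx r m (fun i j => q (r + (m + i)) (r + j)).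
  rewrite -(castmx_nmx (erefl r) (subnK hs)) nmx_row; congr castmx; congr row_mx.
  apply/matrixP => i l; rewrite !mxE /q /stencil_entry;
    have hi := ltn_ord i; have hl := ltn_ord l; do ![case: ifP] => //; lia.
rewrite topE botE -(castmx_nmx e e); congr castmx.
have q_anti i j : ~~ ((i < r) && (j < r))%N -> ~~ ((n - r <= i) && (n - r <= j))%N ->
  q i j = - q j i.
  move=> /negbTE h1 /negbTE h2.
  by rewrite /q [(j < r)%N && _]andbC [(n - r <= j)%N && _]andbC h1 h2 stencil_entry_anti.
rewrite nmx_block; congr block_mx.
- by apply/matrixP => i j; rewrite mxE /q !ltn_ord !idxK.
- rewrite nmx_row; congr row_mx; apply/matrixP => i j; rewrite !mxE /q /stencil_entry.
  have hi := ltn_ord i; have hj := ltn_ord j; do ![case: ifP] => //; lia.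
- rewrite nmx_col; congr col_mx; apply/matrixP => i j; rewrite !mxE.
    by have hi := ltn_ord i; have hj := ltn_ord j; apply: q_anti; lia.
  rewrite /q /stencil_entry.
  have hi := ltn_ord i; have hj := ltn_ord j; do ![case: ifP] => //; lia.
rewrite nmx_block; congr block_mx; apply/matrixP => i j; rewrite !mxE //.
by have hi := ltn_ord i; have hj := ltn_ord j; apply: q_anti; lia.
Qed.

End Assemble.

(** * Integer programs for the stencil and its moments *)

Section Programs.
Implicit Types (c w : Z) (l A : seq Z) (n m s p q j r k : nat) (I : seq nat).

Local Open Scope nat_scope.

Fixpoint powz c n : Z := if n is n'.+1 then Z.mul c (powz c n') else 1%bZ.

Fixpoint geomz c w n : seq Z := if n is n'.+1 then w :: geomz c (Z.mul c w) n' else [::].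

Fixpoint addsz l l' : seq Z :=
  match l, l' with
  | a :: l1, b :: l1' => Z.add a b :: addsz l1 l1'
  | [::], _ => l'
  | _, [::] => l
  end.

Definition momentsz (cw : seq (Z * Z)) n : seq Z :=
  foldr (fun x => addsz (geomz x.1 x.2 n)) [::] cw.

Fixpoint factz n : Z := if n is n'.+1 then Z.mul (Z.of_nat n) (factz n') else 1%bZ.

Definition nthz l m : Z := nth 0%bZ l m.

(** C(2s, s) lcm(1, ..., 15): as alpha_j = +- C(2s, s - j) / (j C(2s, s)), this
    clears the denominators of the stencil for s <= 15. *)
Definition stencil_denz s : Z :=
  (factz s.*2 / (factz s * factz s) * 360360)%bZ.

Definition alpha_numz s j : Z :=
  ((if odd j then 1 else -1) * (stencil_denz s * (factz s * factz s)))%bZ.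
Definition alpha_denz s j : Z :=
  (Z.of_nat j * factz (s - j) * factz (s + j))%bZ.

Definition alphasz s : seq Z :=
  [seq Z.div (alpha_numz s j) (alpha_denz s j) | j <- iota 1 s].

Definition alphas_exact s A : bool :=
  all (fun j => Z.eqb (Z.mul (nthz A j) (alpha_denz s j.+1)) (alpha_numz s j.+1)) (iota 0 s).

Definition stencil_exactz s A : bool :=
  let pos := momentsz [seq (Z.of_nat j.+1, nthz A j) | j <- iota 0 s] s.+1 in
  let neg := momentsz [seq (Z.opp (Z.of_nat j.+1), nthz A j) | j <- iota 0 s] s.+1 in
  all (fun m => Z.eqb (nthz pos m - nthz neg m)
                      (if m == 1 then stencil_denz s else 0%bZ)) (iota 0 s.+1).

(** The sums of alpha_(b - a) a^p b^q at the cut 0, for all q <= s. *)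
Definition half_crossingz s A p : seq Z :=
  momentsz [seq (Z.of_nat i, Z.mul (nthz A j) (powz (Z.of_nat i - Z.of_nat j.+1) p))
           | j <- iota 0 s, i <- iota 0 j.+1] s.+1.

Definition crossingz (T : seq (seq Z)) p q : Z :=
  Z.add (nthz (nth [::] T p) q) (nthz (nth [::] T q) p).

Definition boundary_constz s T m : Z := crossingz T (m - minn m s) (minn m s).

Definition stencil_consistentz s T : bool :=
  Z.eqb (crossingz T 0 0) (stencil_denz s) &&
  all (fun q => all (fun p => (p + q == 0) ||
    Z.eqb (crossingz T p q) (boundary_constz s T (p + q)))
    (iota 0 q.+1)) (iota 0 s.+1).

(** lcm(1, ..., 30): clears the factors 1 / (m + 1) of the moments m < 2s <= 30. *)
Definition lcm30 : Z := 2329089562800%bZ.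

Definition power_sumsz r n : seq Z := momentsz [seq (Z.of_nat k, 1%bZ) | k <- iota 0 r] n.

Definition norm_momentsz s r T : seq Z :=
  let S := power_sumsz r (2 * s) in
  [seq Z.add (Z.mul (Z.mul lcm30 (stencil_denz s)) (nthz S m))
             (Z.mul (Z.div lcm30 (Z.of_nat m.+1)) (boundary_constz s T m.+1))
  | m <- iota 0 (2 * s)].

Definition lcm_exactz s : bool :=
  all (fun m => Z.eqb (Z.mul (Z.of_nat m.+1) (Z.div lcm30 (Z.of_nat m.+1))) lcm30) (iota 0 (2 * s)).

(** From the moments of a linear form L, those of p |-> L((X - c) p). *)
Fixpoint shiftz c l : seq Z :=
  match l with
  | a :: l1 => if l1 is b :: _ then Z.sub b (Z.mul c a) :: shiftz c l1 else [::]
  | [::] => [::]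
  end.

(** The form with moments l applied to the node polynomial, one linear factor at
    a time, without expanding the polynomial. *)
Definition node_momentz I l : Z :=
  head 0%bZ (foldl (fun l' i => shiftz (Z.of_nat i) l') l I).

Definition node_valuez I k : Z :=
  foldr (fun i => Z.mul (Z.of_nat k - Z.of_nat i)) 1%bZ I.

End Programs.

(** Locked, since unfolding would turn large integers into unary numbers. *)
HB.lock Definition Z2R (R : realType) (z : Z) : R := (int_of_Z z)%:~R.

Section Correctness.
Context {R : realType}.
Local Notation Z2R := (@Z2R R).

Lemma Z2RD a b : Z2R (Z.add a b) = Z2R a + Z2R b.
Proof. by rewrite !Z2R.unlock -[Z.add a b]/(a + b) rmorphD intrD. Qed.
Lemma Z2RM a b : Z2R (Z.mul a b) = Z2R a * Z2R b.
Proof. by rewrite !Z2R.unlock -[Z.mul a b]/(a * b) rmorphM intrM. Qed.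
Lemma Z2RN a : Z2R (Z.opp a) = - Z2R a.
Proof. by rewrite !Z2R.unlock -[Z.opp a]/(- a) rmorphN intrN. Qed.
Lemma Z2RB a b : Z2R (Z.sub a b) = Z2R a - Z2R b.
Proof. by rewrite -[Z.sub a b]/(Z.add a (Z.opp b)) Z2RD Z2RN. Qed.
Lemma Z2R0 : Z2R 0%bZ = 0. Proof. by rewrite Z2R.unlock. Qed.
Lemma Z2R1 : Z2R 1%bZ = 1. Proof. by rewrite Z2R.unlock. Qed.
Lemma Z2R_nat n : Z2R (Z.of_nat n) = n%:R.
Proof. by rewrite Z2R.unlock (_ : int_of_Z _ = Posz n) //; lia. Qed.
Lemma Z2R_ge0 z : (0 <= Z2R z) = Z.leb 0 z.
Proof. by rewrite Z2R.unlock ler0z; case: z. Qed.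
Lemma Z2R_gt0 z : (0 < Z2R z) = Z.ltb 0 z.
Proof. by rewrite Z2R.unlock ltr0z; case: z => //= p; lia. Qed.
Definition Z2RE := (Z2RD, Z2RM, Z2RB, Z2RN, Z2R0, Z2R1, Z2R_nat).

Lemma Z2R_powz c n : Z2R (powz c n) = Z2R c ^+ n.
Proof. by elim: n => [|n IH] /=; rewrite Z2RE ?IH ?exprS. Qed.

Lemma Z2R_factz n : Z2R (factz n) = n`!%:R.
Proof.
elim: n => [|n IH]; first by rewrite Z2R1.
rewrite -[factz _]/(Z.mul (Z.of_nat n.+1) (factz n)).
by rewrite Z2RM Z2R_nat IH factS natrM.
Qed.

Lemma nth_geomz c w n m : (m < n)%N -> Z2R (nthz (geomz c w n) m) = Z2R w * Z2R c ^+ m.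
Proof.
elim: n w m => //= n IH w [|m] mn; first by rewrite expr0 mulr1.
by rewrite /nthz /= -/(nthz _ _) IH // Z2RM exprS; ring.
Qed.

Lemma nth_addsz l l' m : Z2R (nthz (addsz l l') m) = Z2R (nthz l m) + Z2R (nthz l' m).
Proof.
rewrite /nthz; elim: l l' m => [|a l IH] [|b l'] [|m] //=;
  by rewrite ?nth_nil ?Z2RD ?IH ?Z2R0 ?addr0 ?add0r.
Qed.

Lemma nth_momentsz cw n m : (m < n)%N ->
  Z2R (nthz (momentsz cw n) m) = \sum_(x <- cw) Z2R x.2 * Z2R x.1 ^+ m.
Proof.
move=> mn; elim: cw => [|x cw IH]; first by rewrite big_nil /nthz nth_nil Z2R0.
by rewrite big_cons -IH /= nth_addsz nth_geomz.
Qed.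

Lemma big_iota n (F : nat -> R) : \sum_(i <- iota 0 n) F i = \sum_(i < n) F i.
Proof. by rewrite -(big_mkord predT) /index_iota subn0. Qed.

Lemma all_iota0 n (a : pred nat) : all a (iota 0 n) -> forall m, (m < n)%N -> a m.
Proof. by move=> /allP h m mn; apply: h; rewrite mem_iota. Qed.

Section Stencil.
Variables (s : nat) (A : seq Z).
Hypothesis hden : Z.ltb 0 (stencil_denz s).
Hypothesis hA : alphas_exact s A.
Let N : R := Z2R (stencil_denz s).

Let N_gt0 : 0 < N.
Proof. by rewrite /N Z2R_gt0. Qed.
Let N_neq0 : N != 0. Proof. by rewrite gt_eqF. Qed.

Lemma Z2R_alphasz j : (j < s)%N -> Z2R (nthz A j) = N * alpha s j.+1.
Proof.
move=> js; have /Z.eqb_eq/(congr1 Z2R) := all_iota0 hA js.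
rewrite /alpha_denz /alpha_numz 6!Z2RM Z2R_nat !Z2R_factz => h.
have d0 : j.+1%:R * (s - j.+1)`!%:R * (s + j.+1)`!%:R != 0 :> R.
  by rewrite !mulf_neq0 ?pnatr_eq0 -?lt0n ?fact_gt0.
apply: (mulIf d0); cbv beta; rewrite h /alpha -[RHS]mulrA divfK // -signr_odd /= negbK.
have Z2RN1 : Z2R (Zneg 1) = -1 by rewrite -[Zneg 1]/(Z.opp 1%bZ) Z2RN Z2R1.
by case: (odd j); rewrite ?Z2RN1 ?Z2R1 /N; ring.
Qed.

Lemma stencil_exactz_correct : stencil_exactz s A -> @exact_stencil R s.
Proof.
move=> h m ms; have /Z.eqb_eq/(congr1 Z2R) := all_iota0 h (ms : (m < s.+1)%N).
rewrite Z2RB !nth_momentsz // !big_map !big_iota -sumrB /odd_moment => e.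
apply: (mulfI N_neq0); rewrite mulr_sumr.
transitivity (Z2R (if m == 1 then stencil_denz s else 0%bZ)); last first.
  by case: eqP; rewrite ?Z2R0 ?mulr1 ?mulr0.
rewrite -e; apply: eq_bigr => j _; cbn [fst snd].
by rewrite Z2R_alphasz // Z2RN Z2R_nat; ring.
Qed.

Let T := [seq half_crossingz s A p | p <- iota 0 s.+1].

Lemma Z2R_crossingz p q : (p <= s)%N -> (q <= s)%N ->
  Z2R (crossingz T p q) = N * crossing s p q 0.
Proof.
move=> ps qs.
have half a b : (a <= s)%N -> (b <= s)%N -> Z2R (nthz (nth [::] T a) b)
    = N * \sum_(j < s) alpha s j.+1 * \sum_(i < j.+1) (i%:R - j.+1%:R) ^+ a * i%:R ^+ b.
  move=> as_ bs; rewrite (nth_map 0%N) ?size_iota // nth_iota // add0n nth_momentsz //.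
  rewrite big_allpairs_dep big_iota mulr_sumr; apply: eq_bigr => j _.
  rewrite big_iota !mulr_sumr; apply: eq_bigr => i _; cbn [fst snd].
  by rewrite Z2RM Z2R_powz Z2RB !Z2R_nat Z2R_alphasz //; ring.
rewrite Z2RD !half // -mulrDr -big_split; congr (_ * _); apply: eq_bigr => j _ /=.
rewrite -mulrDr -big_split; congr (_ * _); apply: eq_bigr => i _ /=.
by rewrite /sym_mon !add0r; ring.
Qed.

Lemma Z2R_boundary_constz m : (m <= 2 * s)%N ->
  Z2R (boundary_constz s T m) = N * boundary_const s m.
Proof. by move=> ms; rewrite Z2R_crossingz //; lia. Qed.

Lemma stencil_consistentz_correct : stencil_consistentz s T -> @consistent_stencil R s.
Proof.
move=> /andP[h0 h] p q pq qs; apply: (mulfI N_neq0).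
have ps := leq_trans pq qs.
case: (eqVneq (p + q)%N 0%N) => e.
  have [-> ->] : p = 0%N /\ q = 0%N by lia.
  move/Z.eqb_eq: h0 => h0.
  by rewrite mulrBr -Z2R_crossingz // h0 !mulr1 mulr0 subrr.
have -> : (p == 0%N)%:R * (q == 0%N)%:R = 0 :> R.
  by rewrite -natrM mulnb (_ : _ && _ = false) //; lia.
rewrite subr0 -Z2R_crossingz // -Z2R_boundary_constz; last by lia.
have := all_iota0 (all_iota0 h (qs : (q < s.+1)%N)) (pq : (p < q.+1)%N).
by rewrite (negbTE e) => /Z.eqb_eq ->.
Qed.

Hypothesis hlcm : lcm_exactz s.
Let K : R := Z2R lcm30.

Lemma Z2R_norm_momentsz r m : (m < 2 * s)%N ->
  Z2R (nthz (norm_momentsz s r T) m) = K * N * norm_moment s r m.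
Proof.
move=> ms; rewrite /nthz (nth_map 0%N) ?size_iota // nth_iota // add0n.
rewrite Z2RD 2!Z2RM [Z2R (Z.mul (Z.div _ _) _)]Z2RM Z2R_boundary_constz // nth_momentsz // big_map big_iota; cbn [fst snd].
have /Z.eqb_eq/(congr1 Z2R) := all_iota0 hlcm ms; rewrite Z2RM Z2R_nat -/N -/K => hK.
rewrite /norm_moment [RHS]mulrDr; congr (_ + _).
  by congr (_ * _); apply: eq_bigr => k _; rewrite Z2R1 mul1r Z2R_nat.
have m0 : m.+1%:R != 0 :> R by rewrite pnatr_eq0.
rewrite -hK; move: (Z2R (Z.div lcm30 _)) N (boundary_const s _) => z N' c.
by move: (m.+1%:R : R) m0 => a a0; field.
Qed.

End Stencil.

Definition shiftmom c (lam : nat -> R) (m : nat) : R := lam m.+1 - c * lam m.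

Lemma momfun_mulXsubC c lam d (p : {poly R}) : (size p <= d)%N ->
  momfun lam d.+1 (('X - c%:P) * p) = momfun (shiftmom c lam) d p.
Proof.
move=> sp; rewrite /momfun mulrBl.
have -> : \sum_(m < d.+1) ('X * p - c%:P * p)`_m * lam m
   = \sum_(m < d.+1) ('X * p)`_m * lam m - \sum_(m < d.+1) c * p`_m * lam m.
  by rewrite -sumrB; apply: eq_bigr => m _; rewrite coefB coefCM mulrBl.
rewrite big_ord_recl coefXM mul0r add0r [X in _ - X]big_ord_recr /=.
rewrite (nth_default _ sp) mulr0 mul0r addr0 -sumrB; apply: eq_bigr => m _.
by rewrite coefXM /shiftmom /=; ring.
Qed.

Lemma Z2R_node_momentz I l d lam : (size I < d)%N -> size l = d ->
  (forall m, (m < d)%N -> Z2R (nthz l m) = lam m) ->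
  Z2R (node_momentz I l) = momfun lam d (nodepoly I).
Proof.
rewrite /node_momentz /nodepoly.
elim: I l d lam => [|i I IH] l [|d] lam //= Id sl hl.
  rewrite big_nil -(expr0 'X) momfunXn // -hl //.
rewrite big_cons momfun_mulXsubC; last by rewrite -/(nodepoly I) size_nodepoly.
apply: IH => //.
  elim: l d {Id hl} sl => [|a [|b l] IH] [|d] //= [sl]; congr S.
  by apply: (IH d); rewrite /= sl.
move=> m md; rewrite /shiftmom -!hl //; last by rewrite ltnS ltnW.
rewrite -(Z2R_nat i) -Z2RM -Z2RB; congr Z2R; rewrite /nthz.
elim: l d m sl md {Id hl} => [|a [|b l] IHl] [|d] m //= [sl].
by case: m => [|m] // md; apply: (IHl d m (congr1 S sl) md).
Qed.

Lemma Z2R_node_valuez I k : Z2R (node_valuez I k) = (nodepoly I).[k%:R].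
Proof.
rewrite horner_nodepoly; elim: I => [|i I IH]; first by rewrite big_nil /= Z2R1.
by rewrite big_cons /= Z2RM IH Z2RB !Z2R_nat.
Qed.

End Correctness.

(** * Certificates for the rows of the table *)

Section Certificates.
Implicit Types (s r : nat) (I : seq nat) (T : seq (seq Z)) (L : seq Z).
Local Open Scope nat_scope.

Definition crossing_table s : seq (seq Z) :=
  let A := alphasz s in [seq half_crossingz s A p | p <- iota 0 s.+1].

Definition stencil_check s : bool :=
  [&& Z.ltb 0 (stencil_denz s), alphas_exact s (alphasz s), stencil_exactz s (alphasz s),
      stencil_consistentz s (crossing_table s) & lcm_exactz s].

Definition sumz L : Z := foldr Z.add 0%bZ L.

(** Below, the nodes come in pairs of consecutive integers except for a block of
    odd length at the right end, so the multiplier, minus the node polynomial, is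
    nonnegative on 0, ..., r - 1. *)
Definition neg_valuesz I r : seq Z := [seq Z.opp (node_valuez I k) | k <- iota 0 r].

(** The last test is L(w) < 0, where w is minus the node polynomial. *)
Definition barrier_check s r I L : bool :=
  [&& size I < 2 * s, all (Z.leb 0) (neg_valuesz I r) & Z.ltb 0 (node_momentz I L)].

(** The two alternatives of [shown_as] for mun / mud, multiplied by mud and by
    10^(e + 3). *)
Definition shown_check (mun mud : Z) (c : nat * nat * nat) : bool :=
  let: (a, f, e) := c in
  let v := Z.mul mun (powz 10%bZ (e + 3)) in
  let d := Z.add (Z.mul 1000%bZ (Z.of_nat a)) (Z.of_nat f) in
  (Z.leb (2 * (v - d * mud)) mud && Z.leb (2 * (d * mud - v)) mud)%bZ
  || (Z.leb (d * mud) v && Z.ltb v (d * mud + mud))%bZ.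

(** With the moments scaled by a common denominator N, V / (N W) is the bound mu
    and [rest] lists N W times the moments of the residual form. *)
Definition optimum_check s r c I L : bool :=
  let P := power_sumsz r (2 * s) in
  let W := sumz (neg_valuesz I r) in
  let V := Z.opp (node_momentz I L) in
  let rest := [seq Z.sub (Z.mul W (nthz L m)) (Z.mul V (nthz P m)) | m <- iota 0 (2 * s)] in
  [&& uniq I && ((size I).+1 == 2 * s), all (fun i => i < r) I,
      all (Z.leb 0) (neg_valuesz I r), Z.ltb 0 W, Z.ltb 0 V,
      all (fun i => Z.leb 0 (Z.mul (node_momentz (rem i I) rest) (node_valuez (rem i I) i))) I
    & shown_check V (Z.mul (Z.mul lcm30 (stencil_denz s)) W) c].

(** Indexed by s: the nodes off which an optimal x equals mu. *)
Definition optimum_nodes : seq (seq nat) :=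
  [:: [::]; [::];
      [:: 1; 2; 3];
      [:: 1; 2; 3; 4; 5];
      [:: 0; 1; 3; 4; 5; 6; 7];
      [:: 0; 1; 3; 4; 5; 6; 8; 9; 10];
      [:: 0; 1; 3; 4; 6; 7; 9; 10; 11; 12; 13];
      [:: 0; 1; 3; 4; 6; 7; 10; 11; 13; 14; 16; 17; 18];
      [:: 0; 1; 3; 4; 6; 7; 10; 11; 14; 15; 17; 18; 20; 21; 22];
      [:: 0; 1; 3; 4; 6; 7; 10; 11; 15; 16; 19; 20; 22; 23; 25; 26; 27];
      [:: 0; 1; 3; 4; 7; 8; 11; 12; 16; 17; 20; 21; 25; 26; 28; 29; 31; 32; 33];
      [:: 0; 1; 3; 4; 7; 8; 11; 12; 16; 17; 21; 22; 26; 27; 31; 32; 34; 35; 37; 38; 39];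
      [:: 0; 1; 3; 4; 7; 8; 11; 12; 16; 17; 22; 23; 28; 29; 33; 34; 38; 39; 41; 42; 44; 45; 46];
      [:: 0; 1; 3; 4; 7; 8; 11; 12; 17; 18; 23; 24; 29; 30; 35; 36; 40; 41; 45; 46; 48; 49; 51; 52; 53];
      [:: 0; 1; 3; 4; 7; 8; 11; 12; 17; 18; 23; 24; 30; 31; 36; 37; 42; 43; 48; 49; 53; 54; 56; 57; 59; 60; 61];
      [:: 0; 1; 3; 4; 7; 8; 12; 13; 17; 18; 24; 25; 31; 32; 38; 39; 44; 45; 51; 52; 57; 58; 61; 62; 65; 66; 68; 69; 70]].

(** Indexed by s: the nodes of a multiplier w with L_(r-1)(w) < 0. *)
Definition barrier_nodes : seq (seq nat) :=
  [:: [::]; [::];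
      [:: 0; 1; 2];
      [:: 0; 1; 2; 3; 4];
      [:: 0; 1; 2; 3; 4; 5; 6];
      [:: 0; 1; 2; 3; 5; 6; 7; 8; 9];
      [:: 0; 1; 2; 3; 5; 6; 8; 9; 10; 11; 12];
      [:: 0; 1; 3; 4; 6; 7; 9; 10; 12; 13; 15; 16; 17];
      [:: 0; 1; 3; 4; 6; 7; 10; 11; 13; 14; 16; 17; 19; 20; 21];
      [:: 0; 1; 3; 4; 6; 7; 10; 11; 14; 15; 18; 19; 21; 22; 24; 25; 26];
      [:: 0; 1; 3; 4; 6; 7; 10; 11; 15; 16; 20; 21; 24; 25; 27; 28; 30; 31; 32];
      [:: 0; 1; 3; 4; 6; 7; 11; 12; 16; 17; 21; 22; 26; 27; 30; 31; 33; 34; 36; 37; 38];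
      [:: 0; 1; 3; 4; 7; 8; 11; 12; 16; 17; 22; 23; 27; 28; 32; 33; 37; 38; 40; 41; 43; 44; 45];
      [:: 0; 1; 3; 4; 7; 8; 11; 12; 16; 17; 22; 23; 28; 29; 34; 35; 39; 40; 44; 45; 47; 48; 50; 51; 52];
      [:: 0; 1; 3; 4; 7; 8; 11; 12; 17; 18; 23; 24; 29; 30; 36; 37; 42; 43; 47; 48; 52; 53; 55; 56; 58; 59; 60];
      [:: 0; 1; 3; 4; 7; 8; 11; 12; 17; 18; 23; 24; 30; 31; 37; 38; 44; 45; 50; 51; 56; 57; 61; 62; 64; 65; 67; 68; 69]].

Definition row_check (row : nat * nat * nat * nat * option nat * (nat * nat * nat)) : bool :=
  let: (s, t, r, dofP, dofD, c) := row in
  let T := crossing_table s in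
  [&& stencil_check s, (t == s) && (2 * s <= r), s < r & (dofP == r - 2 * s)
      && (if dofD is Some d then d == 'C(r - s.+1, 2) else true)] &&
  [&& barrier_check s r.-1 (nth [::] barrier_nodes s) (norm_momentsz s r.-1 T)
    & optimum_check s r c (nth [::] optimum_nodes s) (norm_momentsz s r T)].

Lemma table_checked : all row_check (behead sbp_table) = true.
Proof. vm_cast_no_check (erefl true). Qed.

End Certificates.

Section Soundness.
Context {R : realType}.
Local Notation Z2R := (@Z2R R).

Lemma Z2R_sumz L : Z2R (sumz L) = \sum_(z <- L) Z2R z.
Proof. by elim: L => [|z L IH]; rewrite ?big_nil /= ?Z2R0 // big_cons -IH -Z2RD. Qed.

Lemma neg_valuesz_ge0 I r : all (Z.leb 0) (neg_valuesz I r) ->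
  forall k, (k < r)%N -> 0 <= (- (1 : R) *: nodepoly I).[k%:R].
Proof.
rewrite all_map => h k kr; rewrite hornerZ -Z2R_node_valuez mulN1r -Z2RN Z2R_ge0.
exact: (all_iota0 h kr).
Qed.

Lemma momfun_scale a (lam : nat -> R) d p :
  momfun (fun m => a * lam m) d p = a * momfun lam d p.
Proof. by rewrite /momfun mulr_sumr; apply: eq_bigr => m _; rewrite mulrCA. Qed.

Section Row.
Variable s : nat.
Hypothesis hs : stencil_check s.
Let T := crossing_table s.
Let KN : R := Z2R (Z.mul lcm30 (stencil_denz s)).

Lemma stencil_check_correct : @exact_stencil R s /\ @consistent_stencil R s.
Proof.
case/and5P: hs => h1 h2 h3 h4 h5; split; first exact: stencil_exactz_correct h3.
exact: stencil_consistentz_correct h4.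
Qed.

Let KN_gt0 : 0 < KN.
Proof. by case/and5P: hs => h1 _ _ _ _; rewrite /KN Z2RM mulr_gt0 // Z2R_gt0. Qed.

Lemma Z2R_norm_moments r m : (m < 2 * s)%N ->
  Z2R (nthz (norm_momentsz s r T) m) = KN * norm_moment s r m.
Proof. by case/and5P: hs => h1 h2 h3 h4 h5 ms; rewrite Z2R_norm_momentsz // /KN Z2RM. Qed.

Lemma Z2R_node_moment r I : (size I < 2 * s)%N ->
  Z2R (node_momentz I (norm_momentsz s r T)) = KN * momfun (norm_moment s r) (2 * s) (nodepoly I).
Proof.
move=> sI; rewrite -momfun_scale; apply: Z2R_node_momentz => //.
  by rewrite size_map size_iota.
by move=> m ms; rewrite Z2R_norm_moments.
Qed.

Lemma barrier_correct r r' I (x : 'rV[R]_r') :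
  barrier_check s r I (norm_momentsz s r T) -> (r' <= r)%N ->
  has_moments (2 * s) (norm_moment s r') x -> ~ (forall k, 0 < x 0 k).
Proof.
move=> /and3P[sI hI lt0] r'r; apply: (no_positive_norm r'r (w := -1 *: nodepoly I)).
- by rewrite (leq_trans (size_scale_leq _ _)) // size_nodepoly.
- exact: neg_valuesz_ge0.
rewrite linearZ /= mulN1r oppr_lt0 -(pmulr_rgt0 _ KN_gt0) -Z2R_node_moment //.
by rewrite Z2R_gt0.
Qed.

Lemma shown_check_correct mun mud c : 0 < Z2R mud -> shown_check mun mud c ->
  shown_as (Z2R mun / Z2R mud) c.
Proof.
case: c => [[a f] e] d0; rewrite /shown_check /shown_as /dec_value /dec_unit.
set v := Z.mul mun _; set d := Z.add _ _.
set t : R := 10 ^+ (e + 3).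
have t0 : 0 < t by rewrite exprn_gt0.
have zt : Z2R (powz 10%bZ (e + 3)) = t by rewrite Z2R_powz /t -(Z2R_nat (R := R) 10).
have ve : Z2R v = Z2R mun * t by rewrite /v Z2RM zt.
have de : Z2R d = 1000%:R * a%:R + f%:R by rewrite /d Z2RD Z2RM !Z2R_nat -(Z2R_nat (R := R) 1000).
clearbody v d.
have decE : (a%:R + f%:R / 10%:R ^+ 3) / 10%:R ^+ e = Z2R d / t :> R.
  rewrite de /t exprD; have e0 : (10 : R) ^+ e != 0 by rewrite expf_neq0 ?pnatr_eq0.
  by move: (10 ^+ e : R) e0 => u u0; field.
have muE : Z2R mun / Z2R mud = Z2R v / Z2R mud / t by rewrite ve mulrAC mulfK // gt_eqF.
rewrite decE muE div1r; case/orP => [/andP[h1 h2]|/andP[h1 h2]].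
  left; rewrite -mulrBl normrM (gtr0_norm (x := t^-1)) ?invr_gt0 // mulrC.
  rewrite ler_pM2l ?invr_gt0 // ler_norml.
  have Z2R_le x y : Z.leb x y -> Z2R x <= Z2R y.
    by move=> xy; rewrite -subr_ge0 -Z2RB Z2R_ge0; lia.
  move: (Z2R_le _ _ h1) (Z2R_le _ _ h2); rewrite !Z2RM !Z2RB !Z2RM.
  have -> : Z2R v / Z2R mud - Z2R d = (Z2R v - Z2R d * Z2R mud) / Z2R mud.
    by rewrite mulrBl mulfK // gt_eqF.
  rewrite (_ : Z2R 2%bZ = 2%:R); last by rewrite -(Z2R_nat (R := R) 2).
  move=> g1 g2; rewrite ler_pdivlMr // ler_pdivrMr //; apply/andP; split; lra.
right.
have g1 : 0 <= Z2R v - Z2R d * Z2R mud by rewrite -Z2RM -Z2RB Z2R_ge0; lia.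
have g2 : 0 < Z2R d * Z2R mud + Z2R mud - Z2R v by rewrite -Z2RM -Z2RD -Z2RB Z2R_gt0; lia.
rewrite -{5}[t^-1]mul1r -mulrDl ler_pM2r ?invr_gt0 // ltr_pM2r ?invr_gt0 //.
by rewrite ler_pdivlMr // ltr_pdivrMr // mulrDl mul1r -subr_ge0 g1 -subr_gt0 g2.
Qed.

Lemma optimum_correct r c I : (2 * s <= r)%N ->
  optimum_check s r c I (norm_momentsz s r T) ->
  exists mu : R, [/\ 0 < mu, shown_as mu c,
    (exists x : 'rV[R]_r, [/\ has_moments (2 * s) (norm_moment s r) x,
        forall k, mu <= x 0 k & exists k, x 0 k = mu])
  & (forall (y : 'rV[R]_r) a, has_moments (2 * s) (norm_moment s r) y ->
      (forall k, a <= y 0 k) -> a <= mu)].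
Proof.
move=> hr; rewrite /optimum_check; set P := power_sumsz _ _; set W := sumz _; set V := Z.opp _.
set rest := [seq _ | m <- _].
move=> /and5P[/andP[uI /eqP sI] hI hneg W0 /and3P[V0 hz hsh]].
have sI' : (size I < 2 * s)%N by rewrite -sI.
pose w0 : R := \sum_(k < r) (-1 *: nodepoly I).[k%:R].
have zW : Z2R W = w0.
  rewrite Z2R_sumz !big_map big_iota; apply: eq_bigr => k _.
  by rewrite Z2RN Z2R_node_valuez hornerZ mulN1r.
have zV : Z2R V = KN * momfun (norm_moment s r) (2 * s) (-1 *: nodepoly I).
  by rewrite Z2RN Z2R_node_moment // linearZ /= mulN1r mulrN.
have w0_gt0 : 0 < w0 by rewrite -zW Z2R_gt0.
pose mu := momfun (norm_moment s r) (2 * s) (-1 *: nodepoly I) / w0.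
have muE : mu = Z2R V / Z2R (Z.mul (Z.mul lcm30 (stencil_denz s)) W).
  rewrite zV Z2RM zW -/KN /mu invfM mulrACA divff ?mul1r //.
  by rewrite gt_eqF.
have h3 i : i \in I -> 0 <= momfun
    (fun m => norm_moment s r m - mu * \sum_(k < r) k%:R ^+ m) (2 * s) (nodepoly (rem i I))
    * (nodepoly (rem i I)).[i%:R].
  move=> iI.
  have sz_rem : (size (rem i I) < 2 * s)%N by rewrite size_rem // (leq_ltn_trans (leq_pred _)).
  have := allP hz _ iI; rewrite -(Z2R_ge0 (R := R)) Z2RM Z2R_node_valuez.
  have -> : Z2R (node_momentz (rem i I) rest) = KN * w0 * momfun
      (fun m => norm_moment s r m - mu * \sum_(k < r) k%:R ^+ m) (2 * s) (nodepoly (rem i I)).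
    rewrite -momfun_scale; apply: Z2R_node_momentz => //; first by rewrite size_map size_iota.
    move=> m ms; rewrite /rest /nthz (nth_map 0%N) ?size_iota // nth_iota // add0n.
    rewrite Z2RB [Z2R (Z.mul W _)]Z2RM [Z2R (Z.mul V _)]Z2RM zW zV Z2R_norm_moments //.
    rewrite nth_momentsz // big_map big_iota.
    under eq_bigr => k _ do rewrite [Z2R 1%bZ]Z2R1 mul1r [Z2R _]Z2R_nat.
    rewrite /mu; move: (momfun _ _ _) (\sum_(k < r) _) (norm_moment _ _ _) => a b d.
    have : w0 != 0 by rewrite gt_eqF.
    by move: (KN : R) (w0 : R) => K0 w1 w1_neq0; field.
  by rewrite -mulrA pmulr_rge0 // mulr_gt0.
have := moment_lp (lam := (norm_moment s r : nat -> R)) (sg := -1) uI hI.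
cbv zeta; rewrite sI -/w0 -/mu => H.
have den_gt0 : 0 < Z2R (Z.mul (Z.mul lcm30 (stencil_denz s)) W) by rewrite Z2RM -/KN zW mulr_gt0.
have [h1 h2] := H hr (neg_valuesz_ge0 hneg) w0_gt0 h3.
exists mu; split=> //.
  by rewrite muE divr_gt0 // ?den_gt0 // Z2R_gt0.
by rewrite muE; apply: shown_check_correct.
Qed.

End Row.
End Soundness.

(** * The rows of the table *)

Definition row_claim (R : realType) (s t r dofP : nat) (dofD : option nat)
    (c : nat * nat * nat) : Prop :=
  [/\ (0 < r)%N,
      sbp_exists R s t r,
      (forall r' : nat, (0 < r')%N -> sbp_exists R s t r' -> (r <= r')%N),
      affine_dim (normset s t r : set 'rV[R]_r) dofP
    & (exists2 mu : R, is_mu s t r mu & shown_as mu c) /\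
      (forall d : nat, dofD = Some d ->
         forall x : 'rV[R]_r, is_optimal s t x ->
           affine_dim (boundaryset s t x) d)].

Section Rows.
Context {R : realType}.

Lemma is_mu_of_bound s t r (mu : R) (x : 'rV[R]_r) :
  normset s t r x -> (forall k, mu <= x 0 k) -> (exists k, x 0 k = mu) ->
  (forall (y : 'rV[R]_r) a, normset s t r y -> (forall k, a <= y 0 k) -> a <= mu) ->
  is_mu s t r mu.
Proof.
move=> hx mux [k xk] hy; split.
  exists x => //; split; first by exists k.
  by move=> _ [j _ <-].
by move=> a [y ny [_ ay]]; apply: (hy y) => // j; apply: ay; exists j.
Qed.

Lemma sbp_exists_of_positive s t r (x : 'rV[R]_r) : (s <= r)%N -> (0 < r)%N ->
  (forall k, 0 < x 0 k) -> (exists B, boundaryset s t x B) -> sbp_exists R s t r.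
Proof. by move=> sr r0 x0 [B hB]; split=> // n hn; exact: sbp_of_boundary r0 x0 hB n hn. Qed.

Lemma positive_of_sbp_exists s t r : (0 < r)%N -> sbp_exists R s t r ->
  exists2 x : 'rV[R]_r, (forall k, 0 < x 0 k) & normset s t r x.
Proof.
move=> r0 [_ /(_ _ (leqnn _)) [P [D]]] /(sbp_boundary r0)[x x0 [B hB]].
by exists x => //; exact: boundary_normset r0 _ _ hB.
Qed.

Lemma row_check_correct s t r dofP dofD c :
  row_check (s, t, r, dofP, dofD, c) -> row_claim R s t r dofP dofD c.
Proof.
rewrite /row_check => /andP[/and4P[hs /andP[/eqP -> sr2] sr /andP[/eqP -> hD]] /andP[hbar hopt]].
have r0 : (0 < r)%N by lia.
have [ex cons] := @stencil_check_correct R _ hs.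
have momE r' (x : 'rV[R]_r') : (s <= r')%N ->
    normset s s r' x <-> has_moments (2 * s) (norm_moment s r') x.
  by move=> sr'; exact: normset_moments.
have [mu [mu0 hshow [x [hx mux xk]] hmax]] := @optimum_correct R _ hs _ _ _ sr2 hopt.
have nx : normset s s r x by apply/momE => //; exact: ltnW.
have sP : sbp_exists R s s r.
  apply: (@sbp_exists_of_positive _ _ _ x) => //; first exact: ltnW.
    by move=> k; exact: lt_le_trans (mux k).
  exact: boundaryset_exists.
split=> //.
- move=> r' r'0 ex'; have [sr' _] := ex'.
  have [y y0 ny] := positive_of_sbp_exists r'0 ex'.
  rewrite leqNgt; apply/negP => r'r.
  have r'r1 : (r' <= r.-1)%N by lia.
  exact: (barrier_correct hs hbar r'r1 ((momE _ _ sr').1 ny) y0).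
- have -> : normset s s r = has_moments (2 * s) (norm_moment s r) :> set 'rV[R]_r.
    by apply/predeqP => y; apply: momE; exact: ltnW.
  exact: affine_dim_moments hx.
split.
  exists mu => //; apply: is_mu_of_bound nx mux xk _ => y a /momE hy.
  by apply: hmax; apply: hy; exact: ltnW.
move=> d dE; move: hD; rewrite dE => /eqP -> y [ny _].
exact: boundaryset_dim.
Qed.

Lemma affine_dim_set1 (V : vectType R) (A : set V) (x0 : V) :
  (forall x, A x <-> x = x0) -> affine_dim A 0.
Proof.
move=> hA; exists x0, 0%VS; split; first exact: dimv0.
move=> x; rewrite hA memv0 subr_eq0; split=> [->|/eqP //]; exact: eqxx.
Qed.

(** Here S consists of the single weight 1/2, and B = (-1/2) is forced. *)
Lemma row1_claim : row_claim R 1 1 1 0 (Some 0%N) (5, 0, 1)%N.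
Proof.
have half_neq0 : 2%:R != 0 :> R by rewrite pnatr_eq0.
have a11 : alpha 1 1 = 2%:R^-1 :> R.
  by rewrite /alpha !factS fact0 /= sqrrN !expr1n !mul1r.
have stencil1 : stencil_check 1 by vm_cast_no_check (erefl true).
have [ex cons] := @stencil_check_correct R _ stencil1.
have m0 : norm_moment 1 1 0 = 2%:R^-1 :> R.
  rewrite /norm_moment /boundary_const /crossing /sym_mon !big_ord1 /= a11.
  by field.
have m1 : norm_moment 1 1 1 = 0 :> R.
  rewrite /norm_moment /boundary_const /crossing /sym_mon !big_ord1 /= a11.
  by field.
have nE (x : 'rV[R]_1) : normset 1 1 1 x <-> x = const_mx (2%:R^-1).
  rewrite normset_moments //; split=> [h|-> [|[|m]] // _]; last 2 first.
  - by rewrite big_ord1 m0 mxE mul1r.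
  - by rewrite big_ord1 m1 /= mul0r.
  by apply/matrixP => i j; rewrite !ord1 mxE -m0 -(h 0%N) // big_ord1 mul1r.
have bE (B : 'M[R]_1) : boundaryset 1 1 (const_mx 2%:R^-1) B <-> B = const_mx (- 2%:R^-1).
  split=> [[/matrixP/(_ 0 0) + _]|->].
    rewrite !mxE big_ord1 !mxE /= => h; apply/matrixP => i j; rewrite !ord1 mxE.
    by lra.
  split; first by apply/matrixP => i j; rewrite !ord1 !mxE big_ord1 !mxE /=; lra.
  apply/matrixP => i j; rewrite mul_diag_mx !mxE !big_ord1 !mxE !ord1 /= a11 /dmon.
  by case: j => [[|[|j]]] //= _; rewrite ?expr0 ?expr1; lra.
split=> //.
- apply: (@sbp_exists_of_positive _ _ _ (const_mx 2%:R^-1)) => //.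
    by move=> k; rewrite mxE invr_gt0 ltr0n.
  by exists (const_mx (- 2%:R^-1)); apply/bE.
- exact: affine_dim_set1 nE.
split.
  exists 2%:R^-1; last first.
    left; rewrite /dec_value /dec_unit ?mul0r ?addr0.
    rewrite (_ : _ - _ = 0) ?normr0 ?divr_ge0 ?exprn_ge0 //.
    by field.
  apply: (@is_mu_of_bound _ _ _ _ (const_mx 2%:R^-1)); first exact/nE.
  - by move=> k; rewrite mxE.
  - by exists 0; rewrite mxE.
  by move=> y a /nE -> /(_ 0); rewrite mxE.
by move=> d [<-] x [/nE -> _]; exact: affine_dim_set1 bE.
Qed.

End Rows.

Theorem mainTheorem3 (R : realType) (s t r dofP : nat) (dofD : option nat)
    (c : nat * nat * nat)
    (hrow : (s, t, r, dofP, dofD, c) \in sbp_table) :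
  [/\ (0 < r)%N,
      sbp_exists R s t r,
      (forall r' : nat, (0 < r')%N -> sbp_exists R s t r' -> (r <= r')%N),
      affine_dim (normset s t r : set 'rV[R]_r) dofP
    & (exists2 mu : R, is_mu s t r mu & shown_as mu c) /\
      (forall d : nat, dofD = Some d ->
         forall x : 'rV[R]_r, is_optimal s t x ->
           affine_dim (boundaryset s t x) d)].
Proof.
rewrite -/(row_claim R s t r dofP dofD c).
move: hrow; rewrite (_ : sbp_table = (1, 1, 1, 0, Some 0, (5, 0, 1))%N :: behead sbp_table) //.
rewrite inE => /predU1P[[-> -> -> -> -> ->]|hrow]; first exact: row1_claim.
by apply: row_check_correct; exact: (allP table_checked).
Qed.
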